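(* Let $\Omega\subset\mathbb{R}^2$ be a polygonal domain and let $\mathcal{T}_h$ be a partition of $\Omega$ into convex polygons (hanging nodes allowed and treated as vertices) satisfying the weak Galerkin mesh-regularity conditions described in the context, with $N_K$ elements, $N_F$ interior edges and $N_V$ interior vertices. Let $V_h$, $W_h$, $b(\cdot,\cdot)$ and the functions $\Phi_i,\Upsilon_i,\Lambda_i\in V_h$ be as defined in the context, and let $$D_h=\{\mathbf{v}\in V_h:\ b(\mathbf{v},q)=0\ \ \forall q\in W_h\}.$$ Then $D_h$ is spanned by the following basis functions: $$D_h=\mathrm{Span}\{\Phi_1,\dots,\Phi_{6N_K},\Upsilon_1,\dots,\Upsilon_{N_F},\Lambda_1,\dots,\Lambda_{N_V}\},$$ i.e. these $6N_K+N_F+N_V$ functions form a basis of $D_h$.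
   Context: Mesh. $\mathcal{T}_h$ is a finite partition of the polygonal domain $\Omega\subset\mathbb{R}^2$ into convex polygons (possibly of mixed shapes). It is assumed to satisfy the set of mesh-regularity conditions introduced by Wang and Ye for weak Galerkin methods on polygonal/polyhedral partitions for second order elliptic equations; these are shape-regularity conditions, with fixed constants, on the elements and edges (element areas and edge lengths comparable to the appropriate powers of the element diameter, existence inside each element of a non-degenerate triangle based on each of its edges with height comparable to the element diameter, and existence of shape-regular circumscribed triangles of comparable size with bounded overlap). Hanging nodes are treated as vertices, so edges are the segments between consecutive vertices and each edge not on $\partial\Omega$ is shared by exactly two elements. $\mathcal{F}_h$ is the set of all edges, $\mathcal{F}_h^0=\{e_1,\dots,e_{N_F}\}$ the set of interior edges (those not contained in $\partial\Omega$), $\mathcal{V}_h^0=\{P_1,\dots,P_{N_V}\}$ the set of interior vertices (those not on $\partial\Omega$), and $N_K$ the number of elements. Spaces. $V_h$ consists of pairs $\mathbf{v}=\{\mathbf{v}_0,\mathbf{v}_b\}$, where $\mathbf{v}_0|_T\in[P_1(T)]^2$ for each $T\in\mathcal{T}_h$ (no continuity between elements), $\mathbf{v}_b|_e\in[P_0(e)]^2$ for each edge $e\in\mathcal{F}_h$ (a single value per edge, independent of $\mathbf{v}_0$), and $\mathbf{v}_b=0$ on $\partial\Omega$. $W_h=\{q\in L^2(\Omega):\int_\Omega q=0,\ q|_T\in P_0(T)\ \forall T\in\mathcal{T}_h\}$. Here $P_k$ denotes polynomials of degree at most $k$. Weak divergence. For $\mathbf{v}\in V_h$, $\nabla_w\cdot\mathbf{v}|_T\in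 P_0(T)$ is the unique constant with $(\nabla_w\cdot\mathbf{v},\varphi)_T=-(\mathbf{v}_0,\nabla\varphi)_T+\langle\mathbf{v}_b\cdot\mathbf{n},\varphi\rangle_{\partial T}$ for all $\varphi\in P_0(T)$, where $\mathbf{n}$ is the outward unit normal of $\partial T$ and $(\cdot,\cdot)_T$, $\langle\cdot,\cdot\rangle_{\partial T}$ are $L^2$ inner products. Set $b(\mathbf{v},q)=\sum_{T\in\mathcal{T}_h}(\nabla_w\cdot\mathbf{v},q)_T$. Functions. (i) $\Phi_1,\dots,\Phi_{6N_K}$: for each $T\in\mathcal{T}_h$, six linearly independent functions in $V_h$ whose edge component is zero and whose interior components vanish outside $T$ and form a basis of $[P_1(T)]^2$ on $T$. (ii) $\Upsilon_i$ ($1\le i\le N_F$): the function in $V_h$ with zero interior component and edge component equal to a unit tangent vector $\mathbf{t}_{e_i}$ of $e_i$ on $e_i$ and zero on all other edges. (iii) $\Lambda_i$ ($1\le i\le N_V$): the function in $V_h$ with zero interior component whose edge component equals $\frac{1}{|e|}\mathbf{n}_{e}$ on each edge $e$ having $P_i$ as an endpoint, and zero on all other edges; here $|e|$ is the length of $e$ and $\mathbf{n}_e$ is the unit normal to $e$, all these normals being oriented counterclockwise around $P_i$.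
   Formalization: The polygonal domain Ω is additionally assumed to have connected boundary ∂Ω (no holes, i.e. simply connected); for a domain with a hole, such as a square annulus, dim D_h exceeds 6N_K+N_F+N_V and the claim fails. *)

(* Defs.v *)
From HB Require Import structures.
From mathcomp Require Import all_boot all_order all_algebra.
From mathcomp Require Import all_classical all_reals all_analysis.

Set Implicit Arguments.
Unset Strict Implicit.
Unset Printing Implicit Defensive.
Import Order.TTheory GRing.Theory Num.Theory.
Import numFieldNormedType.Exports.
Local Open Scope classical_set_scope.
Local Open Scope ring_scope.

(* [R^o] rather than [R] so that this is also a [vectType R].  The library norm
   on a product is the maximum norm (same topology as the Euclidean one); the
   Euclidean norm is [enorm] below. *)
Notation plane R := (R^o * R^o)%type.

(* Vector polynomials of degree at most 1, as coefficients: (a, b, c) stands for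
   x |-> a + x_1 b + x_2 c; see [p1_eval].  Elements of a mesh have nonempty
   interior, so [P_1(T)]^2 is the same space for every element T. *)
Notation p1vec R := (plane R * plane R * plane R)%type.

Section Geometry.
Variable R : realType.
Implicit Types (u v x y p q : plane R) (A : set (plane R)) (s : seq (plane R)).
Implicit Types (e : plane R * plane R).

Definition dot u v : R := u.1 * v.1 + u.2 * v.2.
Definition cross u v : R := u.1 * v.2 - u.2 * v.1.
Definition enorm u : R := Num.sqrt (dot u u).
Definition rot90 u : plane R := (- u.2, u.1).

Definition diameter A : R := sup [set enorm (x - y) | x in A & y in A].

Definition boundary A : set (plane R) := closure A `\` interior A.

Definition hull s : set (plane R) :=
  [set x | exists w : 'I_(size s) -> R,
     [/\ forall i, 0 <= w i, \sum_i w i = 1 &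
         x = \sum_i w i *: tnth (in_tuple s) i]].

Definition segment e : set (plane R) :=
  [set (1 - t) *: e.1 + t *: e.2 | t in `[0, 1]].

Definition edge_length e : R := enorm (e.2 - e.1).

Definition area A : \bar R :=
  ((@lebesgue_measure R) \x (@lebesgue_measure R))%E A.

Definition area_integral A (f : plane R -> R) : R :=
  \int[((@lebesgue_measure R) \x (@lebesgue_measure R))%E]_(x in A) f x.

Definition edge_integral e (f : plane R -> R) : R :=
  edge_length e *
  \int[@lebesgue_measure R]_(t in `[0, 1]) f ((1 - t) *: e.1 + t *: e.2).

(* Holes are not excluded here; "no holes" is the separate condition that
   [boundary A] is connected. *)
Definition polygonal_domain A : Prop :=
  [/\ A !=set0, open A, connected A, bounded_set A &
      exists l : seq (plane R * plane R),
        boundary A = [set x | exists2 e, e \in l & segment e x]].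

(* [s] lists the vertices of a convex polygon counterclockwise: every vertex
   lies on the left of, or on, the line through each pair of consecutive
   vertices.  Straight angles (hanging nodes) are allowed.  As the vertices are
   distinct and not all collinear, these conditions force the closed polygon
   through [s] to run exactly once around its convex hull. *)
Definition ccw_convex s : Prop :=
  [/\ uniq s,
      forall p q, p \in s -> q \in s -> 0 <= cross (next s p - p) (q - p) &
      exists p q, [/\ p \in s, q \in s & 0 < cross (next s p - p) (q - p)]].

(* An unoriented edge is represented by the pair of its endpoints in
   lexicographic order. *)
Definition mk_edge p q : plane R * plane R :=
  if (p.1 < q.1) || (p.1 == q.1) && (p.2 <= q.2) then (p, q) else (q, p).

Definition polygon_edges s : seq (plane R * plane R) :=
  [seq mk_edge p (next s p) | p <- s].

(* Outward unit normal on the edge [e] of the polygon [s]; as [s] runs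
   counterclockwise, it is the direction of travel turned by -90 degrees. *)
Definition outer_normal s e : plane R :=
  (if next s e.1 == e.2 then -1 else 1) *:
    ((edge_length e)^-1 *: rot90 (e.2 - e.1)).

(* Unit normal to the edge [e], oriented counterclockwise around its endpoint
   [p]. *)
Definition ccw_normal p e : plane R :=
  (edge_length e)^-1 *: rot90 (if p == e.1 then e.2 - e.1 else e.1 - e.2).

Definition unit_tangent e u : Prop :=
  enorm u = 1 /\ cross (e.2 - e.1) u = 0.

Definition p1_eval (f : p1vec R) x : plane R :=
  f.1.1 + x.1 *: f.1.2 + x.2 *: f.2.

Definition P0 : set (plane R -> R) := [set phi | exists c, phi = cst c].

Definition grad (phi : plane R -> R) x : plane R :=
  ('D_((1, 0) : plane R) phi x, 'D_((0, 1) : plane R) phi x).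

End Geometry.

(* A mesh is the family of the vertex lists of its elements. *)
Section Mesh.
Variables (R : realType) (NK : nat) (T : 'I_NK -> seq (plane R)).
Implicit Types (k l : 'I_NK) (Omega : set (plane R)).

(* The open element; the closed one is [hull (T k)]. *)
Definition cell k : set (plane R) := interior (hull (T k)).

Definition vertices : seq (plane R) := undup (flatten [seq T k | k <- enum 'I_NK]).

Definition edges : seq (plane R * plane R) :=
  undup (flatten [seq polygon_edges (T k) | k <- enum 'I_NK]).

Definition edge := seq_sub edges.

Definition interior_edge Omega : pred edge :=
  fun e => ~~ `[< segment (val e) `<=` boundary Omega >].

Definition interior_vertices Omega : seq (plane R) :=
  [seq p <- vertices | ~~ `[< boundary Omega p >]].

(* The last condition says that hanging nodes are vertices of all the elements
   they touch. *)
Definition convex_mesh Omega : Prop :=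
  [/\ forall k, ccw_convex (T k),
      closure Omega = \bigcup_k hull (T k),
      forall k, cell k `<=` Omega,
      forall k l, k != l -> cell k `&` cell l = set0 &
      forall k l p, p \in T k -> hull (T l) p -> p \in T l].

Record wg_constants := WGConstants {
  rho_v : R; rho_e : R; kappa : R; sigma_min : R; theta0 : R;
  gamma_max : R; rho_S : R; overlap_max : nat }.

Definition elem_diam k : R := diameter (hull (T k)).

(* Shape regularity conditions of Wang and Ye for weak Galerkin methods, in
   dimension 2. *)
Definition regular_size (c : wg_constants) : Prop := forall k,
  ((rho_v c * elem_diam k ^+ 2)%:E <= area (hull (T k)))%E /\
  (forall e, e \in polygon_edges (T k) ->
     rho_e c * diameter (segment e) <= edge_length e).

Definition regular_edges (c : wg_constants) : Prop := forall k e,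
  e \in polygon_edges (T k) -> kappa c * elem_diam k <= diameter (segment e).

(* The angle condition keeps the triangle with base [e] and apex [A] upright:
   the angle from each x - A, x on [e], to the outward normal is at most
   [theta0]. *)
Definition regular_pyramids (c : wg_constants) : Prop := forall k e,
  e \in polygon_edges (T k) ->
  let n := outer_normal (T k) e in
  exists (A : plane R) (sigma : R),
    [/\ hull (T k) A,
        hull [:: e.1; e.2; A] `<=` hull (T k),
        sigma_min c <= sigma,
        dot (e.1 - A) n = sigma * elem_diam k &
        forall x, segment e x ->
          acos (dot (x - A) n / enorm (x - A)) <= theta0 c].

Definition regular_circumscribed (c : wg_constants) : Prop :=
  exists S : 'I_NK -> 3.-tuple (plane R), forall k,
    let hS := diameter (hull (S k)) in
    [/\ hull (T k) `<=` hull (S k),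
        exists z, [set x | enorm (x - z) <= rho_S c * hS] `<=` hull (S k),
        hS <= gamma_max c * elem_diam k &
        (#|[pred l | (l != k) && `[< hull (S k) `&` hull (S l) !=set0 >]]|
           <= overlap_max c)%N].

Definition mesh_regular (c : wg_constants) : Prop :=
  [/\ [/\ 0 < rho_v c, 0 < rho_e c, 0 < kappa c & 0 < sigma_min c],
      [/\ 0 <= theta0 c, theta0 c < pi / 2, 0 < gamma_max c & 0 < rho_S c] &
      [/\ regular_size c, regular_edges c, regular_pyramids c &
          regular_circumscribed c]].

(* Pairs (v_0, v_b), before the boundary condition on v_b is imposed. *)
Definition wg_space : Type :=
  ({ffun 'I_NK -> p1vec R} * {ffun edge -> plane R})%type.
HB.instance Definition _ := Vector.on wg_space.

Implicit Types v : wg_space.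

Definition Vh Omega : set wg_space :=
  [set v : wg_space | forall e, ~~ interior_edge Omega e -> v.2 e = 0].

(* Piecewise constants are only determined almost everywhere: they are
   constrained on the open elements. *)
Definition Wh Omega : set (plane R -> R) :=
  [set q : plane R -> R | [/\ measurable_fun Omega
        (q : measurableTypeR R * measurableTypeR R -> R),
      ((@lebesgue_measure R) \x (@lebesgue_measure R))%E.-integrable Omega
        (EFin \o (fun x => q x ^+ 2)),
      area_integral Omega q = 0 &
      forall k, exists2 phi, P0 phi & {in cell k, q =1 phi}]].

Definition weak_div_spec v k (d : R) : Prop :=
  forall phi, P0 phi ->
    area_integral (cell k) (fun x => d * phi x) =
    - area_integral (cell k) (fun x => dot (p1_eval (v.1 k) x) (grad phi x)) +
    \sum_(e : edge | val e \in polygon_edges (T k))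
      edge_integral (val e)
        (fun x => dot (v.2 e) (outer_normal (T k) (val e)) * phi x).

Definition weak_div v k : R := xget 0 [set d | weak_div_spec v k d].

Definition b v (q : plane R -> R) : R :=
  \sum_k area_integral (cell k) (fun x => weak_div v k * q x).

Definition Dh Omega : set wg_space :=
  [set v : wg_space | Vh Omega v /\ forall q, Wh Omega q -> b v q = 0].

Definition interior_basis (Phi : 'I_NK -> 'I_6 -> wg_space) : Prop :=
  forall k,
    [/\ forall j, (Phi k j).2 = 0,
        forall j l, l != k -> (Phi k j).1 l = 0 &
        basis_of fullv [seq (Phi k j).1 k | j <- enum 'I_6]].

Definition Upsilon (t : edge -> plane R) (e : edge) : wg_space :=
  (0, [ffun e' => if e' == e then t e else 0]).

Definition Lambda (p : plane R) : wg_space :=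
  (0, [ffun e => if (p == (val e).1) || (p == (val e).2)
                 then (edge_length (val e))^-1 *: ccw_normal p (val e) else 0]).

Definition Dh_generators Omega (Phi : 'I_NK -> 'I_6 -> wg_space)
    (t : edge -> plane R) : seq wg_space :=
  [seq Phi k j | k <- enum 'I_NK, j <- enum 'I_6] ++
  [seq Upsilon t e | e <- enum (interior_edge Omega)] ++
  [seq Lambda p | p <- interior_vertices Omega].

End Mesh.

(* Main.v *)
(** The edge components enter the weak divergence only through the fluxes
    [f e], the integrals of [v_b . n_e] over the edges.  A function of [V_h] is in
    [D_h] iff its fluxes out of every element add up to zero: testing with the
    weak divergence itself, which has mean value zero because the two fluxes
    across an interior edge cancel, shows that it vanishes.  The functions [Phi]
    and [Upsilon] account for everything that has no flux, and the flux of
    [sum_p c p Lambda_p] across an edge is the difference of [c] at its endpoints.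
    So one has to show that a divergence-free flux which vanishes on the boundary
    is the gradient of a unique [c] along the edges, with [c = 0] on the boundary.

    Existence: choose a direction not parallel to any edge.  In each element the
    flux is the increment of a local stream function on the boundary of the
    element; let [c p] be the sum of its decrements along the chords cut out by
    the ray from [p] in the chosen direction.  When [p] runs along an edge [e],
    the contributions of an edge [e' <> e] through its two adjacent elements
    cancel, as both are above [e] or neither is, and only the contribution of [e]
    remains.  Hence [c] is constant along the boundary edges, thus on the
    connected boundary, and it is zero at the leftmost vertex.

    Uniqueness: from an interior vertex there is always an edge that goes
    rightwards, so a function that is constant along the interior edges and zero
    on the boundary vanishes. *)

Require Import Defs.
From mathcomp Require Import all_boot all_order all_algebra.
From mathcomp Require Import all_classical all_reals all_analysis.
From mathcomp Require Import ring lra.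
Set Implicit Arguments.
Unset Strict Implicit.
Unset Printing Implicit Defensive.
Import Order.TTheory GRing.Theory Num.Theory.
Import numFieldNormedType.Exports.
Local Open Scope classical_set_scope.
Local Open Scope ring_scope.

(** * Plane geometry and convex polygons *)

Lemma exists_argmin (R : realType) (T : eqType) (f : T -> R)
    (s : seq T) (P : pred T) (x0 : T) :
  x0 \in s -> P x0 ->
  exists x, [/\ x \in s, P x & forall y, y \in s -> P y -> f x <= f y].
Proof.
elim: s x0 => // a s IH x0 x0s Px0.
have [/hasP[x1 x1s Px1]|/hasPn hN] := boolP (has P s).
  have [x [xs Px xmin]] := IH _ x1s Px1.
  have [/andP[Pa fa]|] := boolP (P a && (f a <= f x)).
    exists a; split=> //; first exact: mem_head.
    move=> y; rewrite inE => /orP[/eqP->//|ys] Py.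
    exact: le_trans fa (xmin _ ys Py).
  rewrite negb_and -ltNge => h.
  exists x; split=> //; first by rewrite inE xs orbT.
  move=> y; rewrite inE => /orP[/eqP->|ys] Py; last exact: xmin.
  by move: h; rewrite Py /= => /ltW.
have x0a : x0 = a.
  by move: x0s; rewrite inE => /orP[/eqP//|/hN]; rewrite Px0.
exists a; rewrite mem_head -{1}x0a; split=> // y.
by rewrite inE => /orP[/eqP->//|/hN/negP].
Qed.

(** Rotated so that [x] comes first, the list becomes a path along [next] that reaches every
    member. *)
Lemma next_ind (T : eqType) (s : seq T) (P : T -> Prop) (x : T) :
  uniq s -> x \in s -> P x ->
  (forall y, y \in s -> P y -> P (next s y)) -> forall y, y \in s -> P y.
Proof.
move=> us xs Px hP y ys.
have cyc : fcycle (next s) s by exact: cycle_next.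
have [i s' rs] := rot_to xs.
move: cyc; rewrite -(rot_cycle i) rs /= => cyc.
have : {subset x :: s' <= s} by move=> z; rewrite -rs mem_rot.
have : y \in x :: s' by rewrite -rs mem_rot.
move: cyc; rewrite -cats1 cat_path => /andP[+ _].
elim: s' x xs Px {rs} => [|a s' IH] x xs Px /=; first by rewrite inE => _ /eqP->.
move=> /andP[/eqP xa pa]; rewrite inE => /orP[/eqP->//|ya] sub.
apply: (IH a) => //; rewrite -?xa.
- by rewrite mem_next.
- exact: hP.
- by move=> z zs; apply: sub; rewrite inE -xa zs orbT.
Qed.

Section Plane.
Variable R : realType.
Implicit Types p q x y z u v : plane R.
Implicit Types t : R.

Fact fstDE p q : (p + q).1 = (p.1 : R) + (q.1 : R) :> R. Proof. by []. Qed.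
Fact sndDE p q : (p + q).2 = (p.2 : R) + (q.2 : R) :> R. Proof. by []. Qed.
Fact fstNE p : (- p).1 = - (p.1 : R) :> R. Proof. by []. Qed.
Fact sndNE p : (- p).2 = - (p.2 : R) :> R. Proof. by []. Qed.
Fact fstZE a p : (a *: p).1 = a * (p.1 : R) :> R. Proof. by []. Qed.
Fact sndZE a p : (a *: p).2 = a * (p.2 : R) :> R. Proof. by []. Qed.
Definition coordE := (fstDE, sndDE, fstNE, sndNE, fstZE, sndZE).

Lemma planeP p q : (p.1 : R) = q.1 -> (p.2 : R) = q.2 -> p = q.
Proof. by case: p q => [a b] [c d] /= -> ->. Qed.

Definition conv t p q : plane R := (1 - t) *: p + t *: q.

Lemma cross_conv t u z x y :
  cross u (conv t x y - z) = (1 - t) * cross u (x - z) + t * cross u (y - z).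
Proof. by rewrite /cross /conv !coordE; ring. Qed.

Lemma crossC u v : cross u v = - cross v u.
Proof. by rewrite /cross; ring. Qed.

Lemma cross_line t p q : cross (q - p) (conv t p q - p) = 0.
Proof. by rewrite /cross /conv !coordE; ring. Qed.

Lemma plane_neq0 u : u != 0 -> 0 < dot u u.
Proof.
move=> u0; rewrite /dot -!expr2 lt_neqAle addr_ge0 ?sqr_ge0// andbT eq_sym.
rewrite paddr_eq0 ?sqr_ge0// !sqrf_eq0; apply: contra u0 => /andP[/eqP h1 /eqP h2].
by apply/eqP/planeP.
Qed.

Lemma collinearE u v : u != 0 -> cross u v = 0 -> v = (dot u v / dot u u) *: u.
Proof.
move=> /plane_neq0 u0 c0.
have d0 : dot u u != 0 by rewrite gt_eqF.
apply: planeP; rewrite !coordE; apply: (mulfI d0);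
  rewrite mulrA mulrCA divff// mulr1; move: c0; rewrite /cross /dot => c0.
  have -> : (u.1 * u.1 + u.2 * u.2) * v.1 = (u.1 * v.1 + u.2 * v.2) * u.1
     - u.2 * (u.1 * v.2 - u.2 * v.1) :> R by ring.
  by rewrite c0 mulr0 subr0.
have -> : (u.1 * u.1 + u.2 * u.2) * v.2 = (u.1 * v.1 + u.2 * v.2) * u.2
     + u.1 * (u.1 * v.2 - u.2 * v.1) :> R by ring.
by rewrite c0 mulr0 addr0.
Qed.

Lemma hull_conv (s : seq (plane R)) t x y :
  0 <= t <= 1 -> hull s x -> hull s y -> hull s (conv t x y).
Proof.
move=> /andP[t0 t1] [w [w0 w1 ->]] [w' [w'0 w'1 ->]].
exists (fun i => (1 - t) * w i + t * w' i); split.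
- by move=> i; rewrite addr_ge0// mulr_ge0// subr_ge0.
- by rewrite big_split/= -!mulr_sumr w1 w'1 !mulr1 subrK.
- rewrite /conv !scaler_sumr -big_split; apply: eq_bigr => i _.
  by rewrite [RHS]scalerDl !scalerA.
Qed.

Lemma hull_mem (s : seq (plane R)) x : x \in s -> hull s x.
Proof.
move=> xs; have hi : (index x s < size s)%N by rewrite index_mem.
exists (fun i => (i == Ordinal hi)%:R); split.
- by move=> i; rewrite ler0n.
- by rewrite (bigD1 (Ordinal hi))//= eqxx big1 ?addr0// => i /negbTE->.
- rewrite (bigD1 (Ordinal hi))//= eqxx scale1r big1 ?addr0 //.
    by rewrite (tnth_nth x)/= nth_index.
  by move=> i /negbTE->; rewrite scale0r.
Qed.

(** Half planes are convex, so a linear bound on the hull needs checking only at the listed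
    points. *)
Lemma hull_cross_ge0 (s : seq (plane R)) u a x :
  hull s x -> (forall p, p \in s -> 0 <= cross u (p - a)) ->
  0 <= cross u (x - a).
Proof.
move=> [w [w0 w1 ->]] fs.
have hD y z : cross u (y + z) = cross u y + cross u z.
  by rewrite /cross !coordE; ring.
have hZ c y : cross u (c *: y) = c * cross u y.
  by rewrite /cross !coordE; ring.
have h0 : cross u 0 = 0 by rewrite -(scale0r 0) hZ mul0r.
have -> : \sum_i w i *: tnth (in_tuple s) i - a =
          \sum_i w i *: (tnth (in_tuple s) i - a).
  under [RHS]eq_bigr do rewrite scalerBr.
  by rewrite big_split/= sumrN -scaler_suml w1 scale1r.
rewrite (big_morph (cross u) hD h0); apply: sumr_ge0 => i _.
by rewrite hZ mulr_ge0// fs// mem_tnth.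
Qed.

Lemma segmentP (e : plane R * plane R) x :
  segment e x <-> exists2 t, 0 <= t <= 1 & x = conv t e.1 e.2.
Proof.
split=> [[t /=]|[t t01 ->]].
  by rewrite in_itv/= => t01 <-; exists t.
by exists t => //=; rewrite in_itv/=.
Qed.

End Plane.

(** * Convex polygons as intersections of half planes *)

Section Polygon.
Variables (R : realType) (s : seq (plane R)).
Hypothesis hs : ccw_convex s.
Implicit Types p q r a b w x y z u v d : plane R.
Implicit Types t : R.

Let us : uniq s. Proof. by case: hs. Qed.

(** The closed and the open polygon in terms of the half planes to the left of the edges; the
    agreement with [hull] and its interior is proved below. *)
Definition left_of x := forall p, p \in s -> 0 <= cross (next s p - p) (x - p).
Definition inside x := forall p, p \in s -> 0 < cross (next s p - p) (x - p).

Lemma vertex_left p : p \in s -> left_of p.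
Proof. by case: hs => _ h _ ps q qs; exact: h. Qed.

Lemma hull_left x : hull s x -> left_of x.
Proof. by move=> hx p ps; apply: hull_cross_ge0 hx _ => q /vertex_left; exact. Qed.

Lemma polygon_not_collinear p d : d != 0 ->
  ~ (forall q, q \in s -> cross d (q - p) = 0).
Proof.
move=> d0 h; case: hs => _ _ [p1 [q1 [p1s q1s]]].
have c1 := collinearE d0 (h _ p1s).
have c2 := collinearE d0 (h _ q1s).
have c3 := collinearE d0 (h (next s p1) ltac:(by rewrite mem_next)).
have -> : next s p1 - p1 = (next s p1 - p) - (p1 - p) by rewrite opprB addrA subrK.
have -> : q1 - p1 = (q1 - p) - (p1 - p) by rewrite opprB addrA subrK.
rewrite c1 c2 c3 -!scalerBl /cross !coordE.
by rewrite [X in 0 < X](_ : _ = 0) ?ltxx//; ring.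
Qed.

Lemma next_neq p : p \in s -> next s p != p.
Proof.
move=> ps; apply/eqP => np.
have all_p : forall q, q \in s -> q = p.
  by apply: next_ind us ps _ _ => // y _ ->.
case: hs => _ _ [p1 [q1 [/all_p-> /all_p->]]].
by rewrite subrr /cross /= mulr0 mulr0 subrr ltxx.
Qed.

Lemma edge_dir_neq0 p : p \in s -> next s p - p != 0.
Proof. by move=> /next_neq; rewrite subr_eq0. Qed.

Lemma edge_left p : p \in s ->
  exists2 w, w \in s & 0 < cross (next s p - p) (w - p).
Proof.
move=> ps; apply: contrapT => h.
apply: (polygon_not_collinear (p := p) (edge_dir_neq0 ps)) => q qs.
apply/eqP; rewrite eq_le vertex_left// andbT leNgt.
by apply/negP => h'; apply: h; exists q.
Qed.

Lemma next2_neq p : p \in s -> next s (next s p) != p.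
Proof.
move=> ps; apply/eqP => np.
have all_p : forall q, q \in s -> q = p \/ q = next s p.
  apply: next_ind us ps _ _; first by left.
  by move=> y _ [->|->]; [right|left].
have [w /all_p[]-> ] := edge_left ps.
  by rewrite subrr /cross /= !mulr0 subrr ltxx.
by rewrite crossC -{1}crossC /cross mulrC subrr ltxx.
Qed.

Lemma inside_hull x : inside x -> hull s x.
Proof.
move=> ix; case: (hs) => _ _ [p0 [_ [p0s _ _]]].
have turn p : p \in s -> 0 < cross (p - x) (next s p - x).
  move=> /ix; congr (_ < _); rewrite /cross !coordE; ring.
(* Seen from x, the polygon leaves the half plane to the left of p0 - x between
   p and next p, so that x belongs to the triangle p0, p, next p. *)
have [p [ps c1 c2]] : exists p, [/\ p \in s, 0 < cross (p0 - x) (p - x) &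
    cross (p0 - x) (next s p - x) <= 0].
  apply: contrapT => h.
  have np0 : next s p0 \in s by rewrite mem_next.
  (* The induction starts after [p0] and ends by coming back to it, where the cross product is 0. *)
  have /(_ p0 p0s) : forall y, y \in s -> 0 < cross (p0 - x) (y - x).
    apply: next_ind us np0 (turn _ p0s) _ => y ys y0.
    by rewrite ltNge; apply/negP => y1; apply: h; exists y.
  by rewrite {1}/cross mulrC subrr ltxx.
have A0 := turn _ ps.
(* [A], [B] and [C] are twice the signed areas of the triangles with apex [x]: up to normalisation,
   the barycentric weights of [p0], [p] and [next s p]. *)
set A := cross (p - x) (next s p - x) in A0.
set C := cross (p0 - x) (p - x) in c1.
set B := - cross (p0 - x) (next s p - x).
have B0 : 0 <= B by rewrite /B oppr_ge0.
have BC : 0 < B + C by rewrite ltr_wpDl.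
have ABC : 0 < A + (B + C) by rewrite addr_gt0.
have -> : x = conv (A / (A + (B + C))) (conv (C / (B + C)) p (next s p)) p0.
  have bc0 : B + C != 0 by rewrite gt_eqF.
  have abc0 : A + (B + C) != 0 by rewrite gt_eqF.
  have eA : A = cross (p - x) (next s p - x) by [].
  have eB : B = - cross (p0 - x) (next s p - x) by [].
  have eC : C = cross (p0 - x) (p - x) by [].
  have e1 : 1 - A / (A + (B + C)) = (B + C) / (A + (B + C)) by field.
  have e2 : 1 - C / (B + C) = B / (B + C) by field.
  apply: planeP; rewrite /conv e1 e2 !coordE;
  apply: (mulfI abc0); rewrite mulrDr !mulrA ![(A + (B + C)) * _]mulrC.
    have -> : x.1 * (A + (B + C)) = B * p.1 + C * (next s p).1 + A * p0.1 :> R.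
      by rewrite eA eB eC /cross !coordE; ring.
    by field; rewrite bc0 abc0.
  have -> : x.2 * (A + (B + C)) = B * p.2 + C * (next s p).2 + A * p0.2 :> R.
    by rewrite eA eB eC /cross !coordE; ring.
  by field; rewrite bc0 abc0.
apply: hull_conv; last exact: hull_mem.
  by rewrite divr_ge0 ?(ltW A0) ?(ltW ABC)//= ler_pdivrMr// mul1r lerDl ltW.
apply: hull_conv; [|exact: hull_mem|by apply: hull_mem; rewrite mem_next].
by rewrite divr_ge0 ?(ltW c1) ?(ltW BC)//= ler_pdivrMr// mul1r lerDr.
Qed.

Lemma line_inj d p x y : d != 0 -> cross d (x - p) = 0 -> cross d (y - p) = 0 ->
  dot d x = dot d y -> x = y.
Proof.
move=> d0 hx hy dxy; apply/eqP; rewrite -subr_eq0; apply/eqP.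
have -> : x - y = (dot d (x - y) / dot d d) *: d.
  apply: collinearE => //; rewrite (_ : x - y = (x - p) - (y - p)); last first.
    by rewrite opprB addrA subrK.
  by move: hx hy; rewrite /cross !coordE => hx hy; lra.
have -> : dot d (x - y) = 0 by move: dxy; rewrite /dot !coordE; lra.
by rewrite mul0r scale0r.
Qed.

(** * Vertices on the line through an edge *)

Section Line.
Variables (p : plane R) (ps : p \in s).
Let d := next s p - p.
Let on_line x := cross d (x - p) == 0.

Let d0 : d != 0. Proof. exact: edge_dir_neq0. Qed.
Let dd0 : 0 < dot d d. Proof. exact: plane_neq0. Qed.

Let line_diff x y : on_line x -> on_line y -> exists mu,
  y - x = mu *: d /\ dot d y - dot d x = mu * dot d d.
Proof.
move=> /eqP hx /eqP hy; exists (dot d (y - x) / dot d d); split.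
  apply: collinearE => //; move: hx hy; rewrite /cross !coordE => hx hy; lra.
by rewrite divfK ?gt_eqF// /dot !coordE; ring.
Qed.

(** An edge running against [d] on the same line would have the polygon on its other side, but some
    vertex is strictly to the left of [d]. *)
Lemma next_increases a : a \in s -> on_line a -> on_line (next s a) ->
  dot d a < dot d (next s a).
Proof.
move=> as_ la lna; have [mu [e1 e2]] := line_diff la lna.
rewrite -subr_gt0 e2 mulr_gt0//.
have [w ws w0] := edge_left ps.
have := vertex_left ws as_; rewrite e1.
have -> : cross (mu *: d) (w - a) = mu * (cross d (w - p) - cross d (a - p)).
  by rewrite /cross !coordE; ring.
rewrite (eqP la) subr0 pmulr_lge0// le_eqVlt => /orP[/eqP mu0|//].
by have := edge_dir_neq0 as_; rewrite e1 -mu0 scale0r eqxx.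
Qed.

(** If [next s a] left the line, it would do so to the left, and [x], further along the line, would
    be to the right of the edge from [a]. *)
Lemma next_stays a x : a \in s -> on_line a -> left_of x -> on_line x ->
  dot d a < dot d x -> on_line (next s a).
Proof.
move=> as_ la lx onx; have [mu [e1 e2]] := line_diff la onx.
rewrite -subr_gt0 e2 pmulr_lgt0// => mu0.
have := lx _ as_; rewrite e1.
have -> : cross (next s a - a) (mu *: d) =
    - mu * (cross d (next s a - p) - cross d (a - p)).
  by rewrite /cross !coordE; ring.
rewrite (eqP la) subr0 mulNr oppr_ge0 pmulr_rle0// => h.
by rewrite /on_line eq_le h vertex_left// mem_next.
Qed.

Lemma prev_stays a x : a \in s -> on_line (next s a) -> left_of x -> on_line x ->
  dot d x < dot d (next s a) -> on_line a.
Proof.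
move=> as_ la lx onx; have [mu [e1 e2]] := line_diff la onx.
rewrite -subr_lt0 e2 pmulr_llt0// => mu0.
have := lx _ as_.
have -> : cross (next s a - a) (x - a) = mu * (cross d (a - p) - cross d (next s a - p)).
  rewrite (_ : x - a = (x - next s a) + (next s a - a)); last by rewrite addrA subrK.
  by rewrite e1 /cross !coordE; ring.
rewrite (eqP la) subr0 nmulr_rge0// => h.
by rewrite /on_line eq_le h vertex_left.
Qed.

(** The first vertex on the line, in the direction [d], does not come after [x]: otherwise its
    predecessor would be on the line too, and earlier. Unless it is [x], the last vertex not after
    [x] then has its successor on the line and beyond [x]. *)
Lemma line_edge x : left_of x -> on_line x ->
  exists2 a, a \in s & exists2 t, 0 <= t <= 1 & x = conv t a (next s a).
Proof.
move=> lx onx.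
have onp : on_line p by rewrite /on_line subrr /cross /= !mulr0 subrr.
have [m [ms onm mmin]] := exists_argmin (dot d) ps onp.
have mx : dot d m <= dot d x.
  rewrite leNgt; apply/negP => xm.
  have us_ : prev s m \in s by rewrite mem_prev.
  have nu : next s (prev s m) = m by rewrite next_prev.
  have onu : on_line (prev s m) by apply: (prev_stays (x := x)); rewrite ?nu.
  have := next_increases us_ onu; rewrite nu => /(_ onm).
  by rewrite ltNge mmin.
have Pm : on_line m && (dot d m <= dot d x) by rewrite onm.
have [a [as_ /andP[ona ax] amax]] := exists_argmin (fun q => - dot d q) 
  (P := fun q => on_line q && (dot d q <= dot d x)) ms Pm.
exists a => //.
move: ax; rewrite le_eqVlt => /orP[/eqP ax|ax].
  exists 0; first by rewrite lexx ler01.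
  by rewrite /conv subr0 scale1r scale0r addr0; apply: (line_inj d0 (eqP onx) (eqP ona)).
have onb := next_stays as_ ona lx onx ax.
have ab := next_increases as_ ona onb.
have xb : dot d x < dot d (next s a).
  rewrite ltNge; apply/negP => bx.
  have := amax (next s a); rewrite mem_next as_ onb bx => /(_ isT isT).
  by rewrite lerN2 leNgt ab.
have ab0 : 0 < dot d (next s a) - dot d a by rewrite subr_gt0.
exists ((dot d x - dot d a) / (dot d (next s a) - dot d a)).
  by rewrite divr_ge0 ?(ltW ab0) ?subr_ge0 ?(ltW ax)//= ler_pdivrMr// mul1r; lra.
have [mu [e1 f1]] := line_diff ona onx.
have [nu [e2 f2]] := line_diff ona onb.
rewrite f1 f2 -mulf_div divff ?gt_eqF// mulr1.
have nu0 : nu != 0 by apply: contraTneq ab0; rewrite f2 => ->; rewrite mul0r ltxx.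
have -> : x = a + mu *: d by rewrite -e1 addrC subrK.
have -> : next s a = a + nu *: d by rewrite -e2 addrC subrK.
by apply: planeP; rewrite /conv !coordE; field.
Qed.

Lemma no_vertex_between_line r : r \in s ->
  dot d p < dot d r -> dot d r < dot d (next s p) ->
  on_line r -> False.
Proof.
move=> rs pr rn onr.
have onp : on_line p by rewrite /on_line subrr /cross /= !mulr0 subrr.
have onn : on_line (next s p) by rewrite /on_line /d /cross mulrC subrr.
pose P r := on_line r && has (fun a => [&& on_line a, on_line (next s a),
  dot d a < dot d r & dot d r < dot d (next s a)]) s.
have Pr : P r by rewrite /P onr; apply/hasP; exists p => //; apply/and4P.
(* A vertex r strictly between a and next a yields another such pair further
   left: the predecessor of r is on the line, on one side or the other of a. *)
have [{}r [{}rs {Pr onr pr rn}]] := exists_argmin (dot d) rs Pr.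
move=> /andP[onr /hasP[a as_ /and4P[ona onna ar rna]]] rmin.
have us_ : prev s r \in s by rewrite mem_prev.
have nu : next s (prev s r) = r by rewrite next_prev.
have onu : on_line (prev s r).
  apply: (prev_stays (x := a)); rewrite ?nu//; exact: vertex_left.
have ur : dot d (prev s r) < dot d r.
  by rewrite -[X in _ < dot d X]nu next_increases// nu.
have [ua|au|ua] := ltgtP (dot d (prev s r)) (dot d a).
- have : P a.
    rewrite /P ona; apply/hasP; exists (prev s r) => //; rewrite nu.
    by apply/and4P.
  by move=> /(rmin _ as_); rewrite leNgt ar.
- have : P (prev s r).
    rewrite /P onu; apply/hasP; exists a => //.
    by apply/and4P; split=> //; exact: lt_trans ur rna.
  by move=> /(rmin _ us_); rewrite leNgt ur.
- have ua' : prev s r = a by apply: (line_inj d0 (eqP onu) (eqP ona)).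
  by move: rna; rewrite -ua' nu ltxx.
Qed.

End Line.

Lemma no_vertex_between p t : p \in s -> 0 < t < 1 ->
  conv t p (next s p) \notin s.
Proof.
move=> ps /andP[t0 t1]; apply/negP => rs.
have dd0 : 0 < dot (next s p - p) (next s p - p) by apply/plane_neq0/edge_dir_neq0.
apply: (no_vertex_between_line ps rs); last by rewrite cross_line.
  rewrite -subr_gt0 (_ : _ - _ = t * dot (next s p - p) (next s p - p)) ?mulr_gt0//.
  by rewrite /dot /conv !coordE; ring.
rewrite -subr_gt0 (_ : _ - _ = (1 - t) * dot (next s p - p) (next s p - p)).
  by rewrite mulr_gt0// subr_gt0.
by rewrite /dot /conv !coordE; ring.
Qed.

(** A point that is not strictly to the left of all edges is on the line of one of them, hence on an
    edge. *)
Lemma left_hull x : left_of x -> hull s x.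
Proof.
move=> lx; have [h|/existsNP[p /not_implyP[ps h]]] := pselect (inside x).
  exact: inside_hull.
have onx : cross (next s p - p) (x - p) == 0.
  by rewrite eq_le lx// andbT leNgt; apply/negP.
have [a as_ [t t01 ->]] := line_edge ps lx onx.
by apply: hull_conv => //; apply: hull_mem; rewrite ?mem_next.
Qed.

Lemma not_inside_edge x : hull s x -> ~ inside x ->
  exists2 a, a \in s & exists2 t, 0 <= t <= 1 & x = conv t a (next s a).
Proof.
move=> /hull_left lx /existsNP[p /not_implyP[ps h]].
apply: (line_edge ps lx).
by rewrite eq_le lx// andbT leNgt; apply/negP.
Qed.

Lemma inside_conv t x c : 0 < t <= 1 -> hull s x -> inside c -> inside (conv t x c).
Proof.
move=> /andP[t0 t1] /hull_left hx hc p ps; rewrite cross_conv.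
apply: ltr_wpDl; first by apply: mulr_ge0; [rewrite subr_ge0|exact: hx].
by apply: mulr_gt0 => //; exact: hc.
Qed.

Lemma inside_nonempty : exists c, inside c.
Proof.
case: (hs) => _ _ [p [_ [ps _ _]]].
have [w ws w0] := edge_left ps.
pose q := next s p; have qs : q \in s by rewrite mem_next.
(* The centroid of a nondegenerate triangle: it could fail to be strictly to the left of an edge
   only if all three corners were on the line of that edge. *)
exists (3%:R^-1 *: (p + q + w)) => p' p's.
have := vertex_left ps p's; have := vertex_left qs p's; have := vertex_left ws p's.
set d' := next s p' - p'.
have -> : cross d' (3%:R^-1 *: (p + q + w) - p') =
  3%:R^-1 * (cross d' (p - p') + cross d' (q - p') + cross d' (w - p')).
  by rewrite /cross !coordE; field.
move=> h3 h2 h1; rewrite pmulr_rgt0 ?invr_gt0 ?ltr0n//.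
have [[k1 k2 k3]|//] : [/\ cross d' (p - p') = 0, cross d' (q - p') = 0 &
    cross d' (w - p') = 0] \/
    0 < cross d' (p - p') + cross d' (q - p') + cross d' (w - p').
  have [|h] := ltP 0 (cross d' (p - p') + cross d' (q - p') + cross d' (w - p')).
    by right.
  by left; split; lra.
have d'0 : d' != 0 by apply: edge_dir_neq0.
move: w0.
rewrite (_ : next s p - p = (q - p') - (p - p')); last by rewrite opprB addrA subrK.
rewrite (_ : w - p = (w - p') - (p - p')); last by rewrite opprB addrA subrK.
rewrite (collinearE d'0 k1) (collinearE d'0 k2) (collinearE d'0 k3) -!scalerBl.
by rewrite /cross !coordE [X in 0 < X](_ : _ = 0) ?ltxx//; ring.
Qed.

Lemma edge_not_inside p t : p \in s -> ~ inside (conv t p (next s p)).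
Proof. by move=> ps /(_ p ps); rewrite cross_line ltxx. Qed.

Lemma near_edge p t v : p \in s -> 0 < t < 1 -> 0 < cross (next s p - p) v ->
  exists2 e : R, 0 < e &
    forall dl : R, 0 < dl <= e -> inside (conv t p (next s p) + dl *: v).
Proof.
move=> ps /andP[t0 t1] cv.
have [c ic] := inside_nonempty.
set d := next s p - p in cv *; set z := conv t p _.
have [a [b [b0 ec]]] : exists a b : R, 0 < b /\ c - z = a *: d + b *: v.
  exists (cross (c - z) v / cross d v), (cross d (c - z) / cross d v); split.
    rewrite divr_gt0// (_ : cross d (c - z) = cross d (c - p)) ?ic//.
    by rewrite /z /d /conv /cross !coordE; ring.
  have cv0 : cross d v != 0 by rewrite gt_eqF.
  by apply: planeP; move: cv0; rewrite /cross !coordE => cv0; field.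
pose m := Num.min t (1 - t).
have m0 : 0 < m by rewrite lt_min t0 subr_gt0.
have ma0 : 0 < m + `|a| + 1 by rewrite -addrA ltr_wpDr// addr_ge0.
(* [m] is the room for the shift in the parameter of the edge; this bound makes the weight [k] of
   [c] so small that the shift [mu] stays within it. *)
exists (b * (m / (m + `|a| + 1))); first by rewrite mulr_gt0// divr_gt0.
move=> dl /andP[dl0 dle].
pose k := dl / b.
have k0 : 0 < k by rewrite divr_gt0.
have kle : k * (m + `|a| + 1) <= m.
  by rewrite -ler_pdivlMr// ler_pdivrMr// mulrC.
have a0 : 0 <= `|a| by [].
have k1 : k < 1 by nra.
have k1' : 0 < 1 - k by rewrite subr_gt0.
have ka : k * `|a| <= (1 - k) * m by nra.
pose mu := - (k * a) / (1 - k).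
have mule : `|mu| <= m.
  rewrite normrM normrV ?unitfE ?gt_eqF// (gtr0_norm k1') ler_pdivrMr//.
  by rewrite normrN normrM (gtr0_norm k0) [m * _]mulrC.
have [mt mt1] : m <= t /\ m <= 1 - t by split; rewrite ge_min lexx ?orbT.
move: mule; rewrite ler_norml => /andP[mu1 mu2].
have -> : z + dl *: v = conv k (conv (t + mu) p (next s p)) c.
  have -> : c = z + (a *: d + b *: v) by rewrite -ec addrC subrK.
  have k1n : 1 - k != 0 by rewrite gt_eqF.
  have -> : dl = k * b by rewrite divfK// gt_eqF.
  by apply: planeP; rewrite /mu /z /d /conv !coordE; field.
apply: inside_conv => //; first by rewrite k0 ltW.
apply: hull_conv; [|exact: hull_mem|by apply: hull_mem; rewrite mem_next].
by apply/andP; split; lra.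
Qed.

End Polygon.

(** * Topology of the plane and of polygons *)

Section PlaneTopology.
Variable R : realType.
Implicit Types p q r a b w x y z u v d : plane R.
Implicit Types (t : R) (s : seq (plane R)).

Lemma cross_continuous u a : continuous ((fun x => cross u (x - a)) : plane R -> R^o).
Proof.
move=> x; rewrite /cross.
by apply: cvgB; apply: cvgM; try exact: cvg_cst;
  apply: cvgB; try exact: cvg_cst; [exact: cvg_snd|exact: cvg_fst].
Qed.

Lemma open_line (A : set (plane R)) x v : open A -> A x ->
  exists2 e : R, 0 < e & forall t, 0 <= t <= e -> A (x + t *: v).
Proof.
move=> oA Ax.
have cf : (fun t : R^o => x + t *: v) @ (0 : R^o) --> x + (0 : R) *: v.
  apply: cvgD; first exact: cvg_cst.
  by apply: cvgZl; exact: cvg_id.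
have /cf : nbhs (x + (0 : R) *: v) A.
  by rewrite scale0r addr0; exact: open_nbhs_nbhs.
rewrite /= -filter_from_ballE => -[e /= e0 h].
exists (e / 2); first by rewrite divr_gt0.
move=> t /andP[t0 te]; apply: h; rewrite /ball /= sub0r normrN ger0_norm//.
by rewrite (le_lt_trans te)// ltr_pdivrMr// ltr_pMr// ltr1n.
Qed.

Lemma near_seq (T : Type) (I : eqType) (F : set_system T) (FF : Filter F)
    (s : seq I) (P : I -> set T) :
  (forall i, i \in s -> F (P i)) -> F [set x | forall i, i \in s -> P i x].
Proof.
elim: s => [|i s IH] h; first by apply: filterE => x j.
have h1 : F (P i) by apply: h; exact: mem_head.
have h2 : F [set x | forall i, i \in s -> P i x].
  by apply: IH => j js; apply: h; rewrite inE js orbT.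
apply: filterS (filterI h1 h2) => x [/= Px hx] j.
by rewrite inE => /orP[/eqP->//|/hx].
Qed.

End PlaneTopology.

Section PolygonTopology.
Variables (R : realType) (s : seq (plane R)).
Hypothesis hs : ccw_convex s.
Implicit Types p q r a b w x y z u v d : plane R.

Lemma open_inside : open (inside s).
Proof.
move=> x ix; apply: near_seq => p ps.
have h : nbhs (cross (next s p - p) (x - p) : R^o) [set y | 0 < y].
  by apply: open_nbhs_nbhs; split; [exact: open_gt|exact: ix].
exact: (@cross_continuous R (next s p - p) p x _ h).
Qed.

(** An interior point can be moved a little to the right of any edge without leaving the hull, so it
    was strictly to the left. *)
Lemma interior_hull : interior (hull s) = inside s.
Proof.
apply/seteqP; split=> [x ihx p ps|]; last first.
  rewrite -open_subsetE; last exact: open_inside.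
  by move=> x; exact: inside_hull.
have := open_line (- rot90 (next s p - p)) (open_interior (hull s)) ihx.
move=> [e e0 /(_ e)]; rewrite lexx (ltW e0) => /(_ isT)/interior_subset.
move=> /(hull_left hs)/(_ p ps).
have dd := plane_neq0 (edge_dir_neq0 hs ps).
set d := next s p - p in dd *.
have -> : cross d (x + e *: - rot90 d - p) = cross d (x - p) - e * dot d d.
  by rewrite /cross /dot /rot90 !coordE /=; ring.
by rewrite subr_ge0 => h; apply: lt_le_trans h; rewrite mulr_gt0.
Qed.

Lemma closed_hull : closed (hull s).
Proof.
have -> : hull s = left_of s.
  by apply/seteqP; split=> x; [exact: hull_left|exact: left_hull].
move=> x cx p ps; rewrite leNgt; apply/negP => xneg.
have := @cross_continuous R (next s p - p) p x.
have n0 : nbhs (cross (next s p - p) (x - p) : R^o) [set y | y < 0].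
  by apply: open_nbhs_nbhs; split => //; exact: open_lt.
move=> /(_ _ n0) /= /cx[y [ly /= ]].
by rewrite ltNge ly.
Qed.

End PolygonTopology.

(** * Meshes *)

Section MkEdge.
Variable R : realType.
Implicit Types p q : plane R.

Lemma mk_edgeP p q : mk_edge p q = (p, q) \/ mk_edge p q = (q, p).
Proof. by rewrite /mk_edge; case: ifP; [left|right]. Qed.

Lemma mk_edgeC p q : mk_edge p q = mk_edge q p.
Proof.
rewrite /mk_edge; have [h|h|h] := ltgtP (p.1 : R) (q.1 : R) => //=.
have [h2|h2|h2] := ltgtP (p.2 : R) (q.2 : R) => //=.
by rewrite (planeP h h2).
Qed.

Lemma mk_edge_inj p q p' q' : mk_edge p q = mk_edge p' q' ->
  (p = p' /\ q = q') \/ (p = q' /\ q = p').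
Proof.
by case: (mk_edgeP p q) (mk_edgeP p' q') => -> [] -> [-> ->]; [left|right|right|left].
Qed.

Lemma mk_edge_canonical p q (e : plane R * plane R) :
  e = mk_edge p q -> e = mk_edge e.1 e.2.
Proof.
by case: (mk_edgeP p q) => h -> ; rewrite h /=; rewrite ?(mk_edgeC q) h.
Qed.

Lemma convC t p q : conv t p q = conv (1 - t) q p.
Proof. by apply: planeP; rewrite /conv !coordE; ring. Qed.

Lemma conv0 p q : conv 0 p q = p.
Proof. by apply: planeP; rewrite /conv !coordE; ring. Qed.

Lemma conv1 p q : conv 1 p q = q.
Proof. by apply: planeP; rewrite /conv !coordE; ring. Qed.

Lemma conv_step t p v : p + t *: (v - p) = conv t p v.
Proof. by apply: planeP; rewrite /conv !coordE; ring. Qed.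

Lemma conv_conv t a b p q : conv t (conv a p q) (conv b p q) =
  conv ((1 - t) * a + t * b) p q.
Proof. by apply: planeP; rewrite /conv !coordE; ring. Qed.

Lemma conv_inj p q t t' : p != q -> conv t p q = conv t' p q -> t = t'.
Proof.
move=> pq h.
have d0 : 0 < dot (q - p) (q - p) by apply: plane_neq0; rewrite subr_eq0 eq_sym.
have : dot (q - p) (conv t p q - conv t' p q) = (t - t') * dot (q - p) (q - p).
  by rewrite /dot /conv !coordE; ring.
rewrite h subrr [LHS](_ : _ = 0); last by rewrite /dot /= !mulr0 addr0.
by move/esym/eqP; rewrite mulf_eq0 (gt_eqF d0) orbF subr_eq0 => /eqP.
Qed.

End MkEdge.

(** * How the elements of a mesh meet *)

Section MeshGeometry.
Variables (R : realType) (Omega : set (plane R)) (NK : nat).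
Variable (T : 'I_NK -> seq (plane R)).
Hypothesis oOmega : open Omega.
Hypothesis hm : convex_mesh T Omega.
Implicit Types (p q x y z u v : plane R) (k l : 'I_NK) (t : R) (e : edge T).

Let hT k : ccw_convex (T k). Proof. by case: hm. Qed.
Hint Resolve hT : core.

Lemma cellE k : cell T k = inside (T k).
Proof. exact: interior_hull. Qed.

(** A small move from [x] towards an inner point of [T l] gives a point inside both elements, but
    distinct cells are disjoint. *)
Lemma hull_not_inside k l x : k != l -> hull (T l) x -> ~ inside (T k) x.
Proof.
move=> kl hx ix.
have [c ic] := inside_nonempty (hT l).
have [e e0 he] := open_line (c - x) (@open_inside _ (T k)) ix.
pose t := Num.min e 1.
have t0 : 0 < t by rewrite lt_min e0 ltr01.
have te : t <= e by rewrite ge_min lexx.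
have t1 : t <= 1 by rewrite ge_min lexx orbT.
have := he t; rewrite te (ltW t0) conv_step => /(_ isT) h1.
have h2 : inside (T l) (conv t x c) by apply: inside_conv => //; rewrite t0.
case: hm => _ _ _ /(_ k l kl) + _; rewrite !cellE -subset0.
by move=> /(_ _ (conj h1 h2)).
Qed.

Lemma edge_hull l p t : p \in T l -> 0 <= t <= 1 ->
  hull (T l) (conv t p (next (T l) p)).
Proof. by move=> pT t01; apply: hull_conv => //; apply: hull_mem; rewrite ?mem_next. Qed.

Lemma edge_not_cell k l p t : p \in T l -> 0 <= t <= 1 ->
  ~ inside (T k) (conv t p (next (T l) p)).
Proof.
move=> pT t01; have [->|kl] := eqVneq k l; first exact: edge_not_inside.
by apply: hull_not_inside kl _; exact: edge_hull.
Qed.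

Lemma vertex_conform k l p : p \in T k -> hull (T l) p -> p \in T l.
Proof. by case: hm => _ _ _ _; exact. Qed.

Lemma open_edge_not_vertex k l p t : p \in T l -> 0 < t < 1 ->
  conv t p (next (T l) p) \notin T k.
Proof.
move=> pT t01; apply/negP => h; have /negP := no_vertex_between (hT l) pT t01.
apply; apply: vertex_conform h _; apply: edge_hull => //.
by case/andP: t01 => /ltW-> /ltW->.
Qed.

Lemma hull_closure l x : hull (T l) x -> closure Omega x.
Proof. by case: hm => _ -> _ _ _ hx; exists l. Qed.

Lemma closure_hull x : closure Omega x -> exists l, hull (T l) x.
Proof. by case: hm => _ -> _ _ _ [l _ hx]; exists l. Qed.

Lemma not_boundary x : closure Omega x -> ~ boundary Omega x -> Omega x.
Proof.
rewrite /boundary => cx nb; apply: contrapT => nO; apply: nb; split => //.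
by move/interior_subset.
Qed.

Lemma boundary_not x : boundary Omega x -> ~ Omega x.
Proof. by move=> [_ +]; apply: contra_not; move/interior_id: oOmega => ->. Qed.

(** Elements are closed and finite in number, so an element that contains a point close enough to
    [x] contains [x] as well. *)
Lemma local_cover x v : Omega x ->
  exists2 t : R, 0 < t & exists2 l, hull (T l) x & hull (T l) (x + t *: v).
Proof.
move=> Ox.
have nO : nbhs x Omega by exact: open_nbhs_nbhs.
have nh : nbhs x [set y | forall l, l \in enum 'I_NK -> hull (T l) y -> hull (T l) x].
  apply: near_seq => l _.
  have [hx|nx] := pselect (hull (T l) x); first by apply: filterE.
  have : nbhs x (~` hull (T l)).
    apply: open_nbhs_nbhs; split => //; apply: closed_openC.
    exact: closed_hull.
  by apply: filterS => y.
have : nbhs x (Omega `&`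
    [set y | forall l, l \in enum 'I_NK -> hull (T l) y -> hull (T l) x]).
  exact: filterI.
rewrite nbhsE => -[U [oU Ux] UO].
have [e e0 /(_ e)] := open_line v oU Ux; rewrite lexx (ltW e0) => /(_ isT)/UO [h0 h1].
have [l hl] := closure_hull (subset_closure h0).
exists e => //; exists l => //.
by apply: h1 hl; rewrite mem_enum.
Qed.

(** If the edges crossed transversally, one of the two directions along the second would lead into
    the inside of [T l], where no edge has a point. *)
Lemma crossing_edges_parallel k l p q t t' : p \in T l -> q \in T k ->
  0 < t < 1 -> 0 < t' < 1 -> conv t p (next (T l) p) = conv t' q (next (T k) q) ->
  cross (next (T l) p - p) (next (T k) q - q) = 0.
Proof.
move=> pT qT t01 t'01 ez; apply/eqP/negPn/negP => c0.
have [s s1 cs] : exists2 s : R, `|s| = 1 & 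
    0 < cross (next (T l) p - p) (s *: (next (T k) q - q)).
  have crossZ s : cross (next (T l) p - p) (s *: (next (T k) q - q)) = 
      s * cross (next (T l) p - p) (next (T k) q - q).
    by rewrite /cross !coordE; ring.
  exists (Num.sg (cross (next (T l) p - p) (next (T k) q - q))).
    by rewrite normr_sg c0.
  by rewrite crossZ -normrEsg normr_gt0.
have [e e0 he] := near_edge (hT l) pT t01 cs.
case/andP: t'01 => t'0 t'1.
pose dl := Num.min e (Num.min t' (1 - t')).
have dl0 : 0 < dl by rewrite !lt_min e0 t'0 subr_gt0.
have dle : dl <= e by rewrite ge_min lexx.
have dlt : dl <= t' by rewrite !ge_min lexx !orbT.
have dlt1 : dl <= 1 - t' by rewrite !ge_min lexx !orbT.
have := he dl; rewrite dl0 dle => /(_ isT).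
have -> : conv t p (next (T l) p) + dl *: (s *: (next (T k) q - q)) =
    conv (t' + dl * s) q (next (T k) q).
  by rewrite ez; apply: planeP; rewrite /conv !coordE; ring.
apply: edge_not_cell => //.
have : `|dl * s| <= dl by rewrite normrM s1 mulr1 gtr0_norm.
by rewrite ler_norml => /andP[h1 h2]; apply/andP; split; lra.
Qed.

(** The edges lie on one line, so the ends of the second have parameters [a] and [b] along the
    first. By conformity no end of either edge is strictly inside the other, which leaves 0 and 1,
    in either order. *)
Lemma open_edges_disjoint k l p q t t' : p \in T l -> q \in T k ->
  0 < t < 1 -> 0 < t' < 1 -> conv t p (next (T l) p) = conv t' q (next (T k) q) ->
  (p = q /\ next (T l) p = next (T k) q) \/ (p = next (T k) q /\ next (T l) p = q).
Proof.
move=> pT qT t01 t'01 ez.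
have c0 := crossing_edges_parallel pT qT t01 t'01 ez.
have qT' : next (T k) q \in T k by rewrite mem_next.
have pT' : next (T l) p \in T l by rewrite mem_next.
have pn := next_neq (hT l) pT; have qn := next_neq (hT k) qT.
have no1 c : 0 < c < 1 -> conv c p (next (T l) p) \in T k -> False.
  by move=> c01 h; have /negP := open_edge_not_vertex k pT c01; apply.
have no2 c : 0 < c < 1 -> conv c q (next (T k) q) \in T l -> False.
  by move=> c01 h; have /negP := open_edge_not_vertex l qT c01; apply.
have d0 : next (T l) p - p != 0 by rewrite subr_eq0.
have [mu emu] : exists mu, next (T k) q - q = mu *: (next (T l) p - p).
  by eexists; exact: collinearE d0 c0.
move: (next (T l) p) (next (T k) q) => p' q' in pT' qT' ez pn qn no1 no2 emu d0 *.
clear c0.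
have [a ea] : exists a, q = conv a p p'.
  exists (t - t' * mu).
  have -> : q = conv t p p' - t' *: (q' - q).
    by rewrite ez; apply: planeP; rewrite /conv !coordE; ring.
  by rewrite emu; apply: planeP; rewrite /conv !coordE; ring.
have [b eb] : exists b, q' = conv b p p'.
  exists (a + mu).
  have -> : q' = q + (q' - q) by rewrite addrC subrK.
  by rewrite emu ea; apply: planeP; rewrite /conv !coordE; ring.
have ab : a != b by apply: contraNneq qn => ab; rewrite ea eb ab.
have et : t = (1 - t') * a + t' * b.
  by apply: (@conv_inj _ p p'); rewrite 1?eq_sym// ez ea eb conv_conv.
have na : ~ 0 < a < 1 by move=> /no1; rewrite -ea qT; exact.
have nb : ~ 0 < b < 1 by move=> /no1; rewrite -eb qT'; exact.
have ba : b - a != 0 by rewrite subr_eq0 eq_sym.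
have sep s : s = (1 - (s - a) / (b - a)) * a + (s - a) / (b - a) * b by field.
(* [(0 - a) / (b - a)] and [(1 - a) / (b - a)] are the parameters of [p] and [p'] along the second
   edge. *)
have n0 : ~ 0 < (0 - a) / (b - a) < 1.
  by move=> /no2; rewrite ea eb conv_conv -sep conv0; exact.
have n1 : ~ 0 < (1 - a) / (b - a) < 1.
  by move=> /no2; rewrite ea eb conv_conv -sep conv1; exact.
case/andP: t01 => t0 t1; case/andP: t'01 => t'0 t'1.
have [{ab}ab|{}ab] := ltP a b.
  have ab' : 0 < b - a by rewrite subr_gt0.
  rewrite ltr_pdivrMr// ltr_pdivlMr// mul0r mul1r in n0.
  rewrite ltr_pdivrMr// ltr_pdivlMr// mul0r mul1r in n1.
  have at0 : 0 < t' * (b - a) by rewrite mulr_gt0.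
  have bt0 : 0 < (1 - t') * (b - a) by rewrite mulr_gt0// subr_gt0.
  have a0 : a <= 0.
    rewrite leNgt; apply/negP => a0; apply: na; rewrite a0/=; lra.
  have b1 : 1 <= b.
    rewrite leNgt; apply/negP => b1; apply: nb; rewrite b1 andbT; lra.
  have ea0 : a = 0.
    apply/eqP; rewrite eq_le a0 leNgt; apply/negP => h; apply: n0; lra.
  have eb1 : b = 1.
    apply/eqP; rewrite eq_le b1 andbT leNgt; apply/negP => h; apply: n1; lra.
  by left; rewrite ea eb ea0 eb1 conv0 conv1.
have ba' : b < a by rewrite lt_neqAle ab eq_sym -subr_eq0 -opprB oppr_eq0 ba.
have ab' : b - a < 0 by rewrite subr_lt0.
rewrite ltr_ndivrMr// ltr_ndivlMr// mul0r mul1r in n0.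
rewrite ltr_ndivrMr// ltr_ndivlMr// mul0r mul1r in n1.
have at0 : 0 < t' * (a - b) by rewrite mulr_gt0// subr_gt0.
have bt0 : 0 < (1 - t') * (a - b) by rewrite mulr_gt0// subr_gt0.
have b0 : b <= 0.
  rewrite leNgt; apply/negP => b0; apply: nb; rewrite b0/=; lra.
have a1 : 1 <= a.
  rewrite leNgt; apply/negP => a1; apply: na; rewrite a1 andbT; lra.
have eb0 : b = 0.
  apply/eqP; rewrite eq_le b0 leNgt; apply/negP => h; apply: n0; lra.
have ea1 : a = 1.
  apply/eqP; rewrite eq_le a1 andbT leNgt; apply/negP => h; apply: n1; lra.
by right; rewrite ea eb ea1 eb0 conv0 conv1.
Qed.

(** An element lies to the left of its edges, so points slightly to the left of the midpoint would
    be in both cells. *)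
Lemma same_side k l p : p \in T k -> p \in T l -> next (T k) p = next (T l) p -> k = l.
Proof.
move=> pk pl epl; apply/eqP/negPn/negP => kl.
have d0 := edge_dir_neq0 (hT k) pk.
have c0 : 0 < cross (next (T k) p - p) (rot90 (next (T k) p - p)).
  have := plane_neq0 d0; rewrite /cross /dot /= mulrN opprK; exact.
have h01 : 0 < (2%:R^-1 : R) < 1 by rewrite invr_gt0 ltr0n invf_lt1 ?ltr0n// ltr1n.
have [e e0 he] := near_edge (hT k) pk h01 c0.
rewrite epl in c0.
have [f f0 hf] := near_edge (hT l) pl h01 c0.
pose m := Num.min e f.
have m0 : 0 < m by rewrite lt_min e0.
have := he m; rewrite m0 ge_min lexx => /(_ isT); rewrite epl => h1.
have := hf m; rewrite m0 ge_min lexx orbT => /(_ isT) h2.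
case: hm => _ _ _ /(_ k l kl) + _; rewrite !cellE -subset0 => /(_ _ (conj h1 h2)).
exact.
Qed.

Lemma edge_meets_open l p t : p \in T l -> 0 <= t <= 1 ->
  Omega (conv t p (next (T l) p)) ->
  exists2 t' : R, 0 < t' < 1 & Omega (conv t' p (next (T l) p)).
Proof.
move=> pT /andP[t0 t1] Ox; set x := conv _ _ _ in Ox.
have [e e0 he] := open_line (conv 2%:R^-1 p (next (T l) p) - x) oOmega Ox.
pose m := Num.min e 1.
have m0 : 0 < m by rewrite lt_min e0 ltr01.
have m1 : m <= 1 by rewrite ge_min lexx orbT.
have := he m; rewrite (ltW m0) ge_min lexx => /(_ isT).
rewrite conv_step conv_conv => h; eexists; last exact: h.
by apply/andP; split; nra.
Qed.

(** Some element contains a point of the open edge and a point to the right of it. The former is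
    inside no element, so it is on an edge of this one, which must be the same edge run through the
    other way. *)
Lemma opposite_side l p t : p \in T l -> 0 <= t <= 1 ->
  Omega (conv t p (next (T l) p)) ->
  exists2 k, next (T l) p \in T k & next (T k) (next (T l) p) = p.
Proof.
move=> pT t01 /(edge_meets_open pT t01)[{t01}t t01 Ox].
set q := next (T l) p in Ox *.
have d0 := plane_neq0 (edge_dir_neq0 (hT l) pT).
have [e e0 [k hx hy]] := local_cover (- rot90 (q - p)) Ox.
have yneg : cross (q - p) (conv t p q + e *: - rot90 (q - p) - p) < 0.
  rewrite (_ : cross _ _ = - (e * dot (q - p) (q - p))) ?oppr_lt0 ?mulr_gt0//.
  by rewrite /cross /dot /conv /rot90 !coordE /=; ring.
have t01' : 0 <= t <= 1 by case/andP: t01 => /ltW-> /ltW->.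
have [a aT [t' t'01 ex]] := not_inside_edge (hT k) hx (edge_not_cell (k := k) pT t01').
have nxk : conv t p q \notin T k by exact: open_edge_not_vertex.
have t'01' : 0 < t' < 1.
  case/andP: t'01 => t'0 t'1; rewrite !lt_neqAle t'0 t'1 !andbT; apply/andP; split.
    by apply: contraNneq nxk => h; rewrite ex -h conv0.
  by apply: contraNneq nxk => h; rewrite ex h conv1 mem_next.
have [[ap aq]|[ap aq]] := open_edges_disjoint pT aT t01 t'01' ex.
  have := hull_left (hT k) hy aT; rewrite -aq -ap => h.
  by move: yneg; rewrite ltNge h.
by have qa : q = a by []; exists k; rewrite qa.
Qed.

End MeshGeometry.

(** * Orientation of edges and sums over them *)

Section MeshEdges.
Variables (R : realType) (Omega : set (plane R)) (NK : nat).
Variable (T : 'I_NK -> seq (plane R)).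
Hypothesis oOmega : open Omega.
Hypothesis hm : convex_mesh T Omega.
Implicit Types (p q x y z u v : plane R) (k l : 'I_NK) (t : R) (e : edge T).

Let hT k : ccw_convex (T k). Proof. by case: hm. Qed.
Hint Resolve hT : core.
Let uT k : uniq (T k). Proof. by case: (hT k). Qed.

Definition oriented k p q := (p \in T k) && (next (T k) p == q).

(** The outward normal of [k] on its edge [e] is this sign times the direction of
    [rot90 ((val e).2 - (val e).1)]; the value is 0 when [e] is no edge of [k]. *)
Definition esgn k e : R :=
  (oriented k (val e).2 (val e).1)%:R - (oriented k (val e).1 (val e).2)%:R.

Lemma polygon_edgesP k (x : plane R * plane R) :
  reflect (exists2 p, p \in T k & x = mk_edge p (next (T k) p))
          (x \in polygon_edges (T k)).
Proof. exact: mapP. Qed.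

Lemma mem_edges (x : plane R * plane R) :
  reflect (exists k, x \in polygon_edges (T k)) (x \in edges T).
Proof.
rewrite /edges mem_undup; apply: (iffP flattenP) => [[s /mapP[k _ ->] xs]|[k xk]].
  by exists k.
by exists (polygon_edges (T k)) => //; apply/mapP; exists k; rewrite ?mem_enum.
Qed.

Lemma edge_of k p : p \in T k -> exists e, val e = mk_edge p (next (T k) p).
Proof.
move=> pk; have h : mk_edge p (next (T k) p) \in edges T.
  by apply/mem_edges; exists k; apply/polygon_edgesP; exists p.
by exists (SeqSub h).
Qed.

Lemma edge_canonical e : val e = mk_edge (val e).1 (val e).2.
Proof.
have /mem_edges[k /polygon_edgesP[p _ h]] := valP e.
exact: mk_edge_canonical h.
Qed.

Lemma mem_polygon_edges k e :
  (val e \in polygon_edges (T k)) =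
  oriented k (val e).1 (val e).2 || oriented k (val e).2 (val e).1.
Proof.
apply/polygon_edgesP/orP => [[p pk]|].
  rewrite {1}edge_canonical => /mk_edge_inj[][-> ->]; rewrite /oriented pk eqxx.
    by left.
  by right.
rewrite {5}edge_canonical; case=> /andP[pk /eqP h].
  by exists (val e).1; rewrite ?h.
by exists (val e).2; rewrite ?h// mk_edgeC.
Qed.

Lemma oriented_asym k p q : oriented k p q -> ~~ oriented k q p.
Proof.
move=> /andP[pk /eqP <-]; apply/negP => /andP[_].
by rewrite (negbTE (next2_neq (hT k) pk)).
Qed.

Lemma oriented_neq k p q : oriented k p q -> p != q.
Proof. by move=> /andP[pk /eqP <-]; rewrite eq_sym next_neq. Qed.

Lemma oriented_inj k l p q : oriented k p q -> oriented l p q -> k = l.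
Proof.
move=> /andP[pk /eqP h] /andP[pl /eqP h'].
by apply: (same_side hm pk pl); rewrite h h'.
Qed.

Lemma oriented_mem k p q : oriented k p q -> p \in T k /\ q \in T k.
Proof. by move=> /andP[pk /eqP <-]; rewrite mem_next. Qed.

Lemma edge_oriented e : exists k, 
  oriented k (val e).1 (val e).2 || oriented k (val e).2 (val e).1.
Proof.
have /mem_edges[k] := valP e; rewrite mem_polygon_edges => h; by exists k.
Qed.

Lemma esgnE k e : esgn k e =
  if val e \in polygon_edges (T k) then
    if next (T k) (val e).1 == (val e).2 then -1 else 1
  else 0.
Proof.
rewrite mem_polygon_edges /esgn.
have [h|h] := boolP (oriented k (val e).1 (val e).2); rewrite ?orTb ?orFb.
  by rewrite (negbTE (oriented_asym h)) sub0r; case/andP: h => _ ->.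
have [h'|h'] := boolP (oriented k (val e).2 (val e).1); last by rewrite subr0.
rewrite subr0; case: ifP => // h''.
by move: h; rewrite /oriented h'' andbT (oriented_mem h').2.
Qed.

Lemma edge_neq e : (val e).1 != (val e).2.
Proof.
by have [k /orP[/oriented_neq//|/oriented_neq]] := edge_oriented e; rewrite eq_sym.
Qed.

(* The orientation in which an edge is stored need not be the one in which the
   element [k] runs along it, hence the two parameters. *)
Lemma edge_param e : exists k p, [/\ p \in T k,
  forall t, exists2 t', conv t (val e).1 (val e).2 = conv t' p (next (T k) p) &
    (0 < t < 1 -> 0 < t' < 1) /\ (0 <= t <= 1 -> 0 <= t' <= 1) &
  val e = mk_edge p (next (T k) p)].
Proof.
have [k /orP[]/andP[pk /eqP h]] := edge_oriented e; exists k.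
  by exists (val e).1; split=> //; rewrite h -?edge_canonical// => t; exists t.
exists (val e).2; split=> //; rewrite h; last by rewrite mk_edgeC -edge_canonical.
move=> t; exists (1 - t); first by rewrite convC.
by split=> /andP[h1 h2]; apply/andP; split; lra.
Qed.

Lemma edge_not_in_cell k e t : 0 <= t <= 1 ->
  ~ inside (T k) (conv t (val e).1 (val e).2).
Proof.
move=> t01; have [l [p [pl /(_ t)[t' -> [_ /(_ t01) t'01] _]]]] := edge_param e.
exact: (edge_not_cell hm).
Qed.

Lemma edges_disjoint e e' t t' : 0 < t < 1 -> 0 < t' < 1 ->
  conv t (val e).1 (val e).2 = conv t' (val e').1 (val e').2 -> e = e'.
Proof.
move=> t01 t'01.
have [l [p [pl /(_ t)[s -> [/(_ t01) s01 _] he]]]] := edge_param e.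
have [k [q [qk /(_ t')[s' -> [/(_ t'01) s'01 _] he']]]] := edge_param e'.
move=> /(open_edges_disjoint hm pl qk s01 s'01) h; apply: val_inj.
by rewrite he he'; case: h => -[-> ->] //; rewrite mk_edgeC.
Qed.

Lemma edge_not_vertex k e t : 0 < t < 1 ->
  conv t (val e).1 (val e).2 \notin T k.
Proof.
move=> t01; have [l [p [pl /(_ t)[s -> [/(_ t01) s01 _] _]]]] := edge_param e.
exact: (open_edge_not_vertex hm).
Qed.

Lemma edge_closure e t : 0 <= t <= 1 ->
  closure Omega (conv t (val e).1 (val e).2).
Proof.
move=> t01; have [l [p [pl /(_ t)[t' -> [_ /(_ t01) t'01] _]]]] := edge_param e.
by apply: (hull_closure hm (l := l)); exact: edge_hull.
Qed.

Lemma interior_edge_meets e : interior_edge Omega e ->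
  exists2 t, 0 <= t <= 1 & Omega (conv t (val e).1 (val e).2).
Proof.
move=> /negP ie.
have /existsNP[x /not_implyP[/segmentP[t t01 ->] nb]] :
    ~ (forall x, segment (val e) x -> boundary Omega x).
  by move=> h; apply: ie; exact/asboolP.
exists t => //; apply: (not_boundary _ nb); exact: edge_closure.
Qed.

Lemma not_interior_edge e t : ~~ interior_edge Omega e -> 0 <= t <= 1 ->
  ~ Omega (conv t (val e).1 (val e).2).
Proof.
move=> /negPn/asboolP h t01; apply: (boundary_not oOmega).
by apply: h; apply/segmentP; exists t.
Qed.

(** The second element comes from [opposite_side], and there is no third because an oriented edge
    belongs to one element only. Sums over the elements thus become jumps across [e]. *)
Lemma interior_edge_sides e : interior_edge Omega e ->
  exists k l, [/\ oriented k (val e).1 (val e).2, oriented l (val e).2 (val e).1 &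
    forall a : 'I_NK -> R, \sum_j a j * esgn j e = a l - a k].
Proof.
move=> ie.
have [t t01 Ox] := interior_edge_meets ie.
have [k [l [hk hl]]] : exists k l,
    oriented k (val e).1 (val e).2 /\ oriented l (val e).2 (val e).1.
  have [k /orP[]/andP[pk /eqP h]] := edge_oriented e.
    rewrite -h in Ox; have [l h1 h2] := opposite_side oOmega hm pk t01 Ox.
    by exists k, l; rewrite /oriented pk -h h1 h2 !eqxx.
  have t01' : 0 <= 1 - t <= 1 by move: t01 => /andP[h1 h2]; apply/andP; split; lra.
  rewrite -h convC in Ox; have [l h1 h2] := opposite_side oOmega hm pk t01' Ox.
  by exists l, k; rewrite /oriented pk -h h1 h2 !eqxx.
have kl : l != k.
  by apply: contraTneq hl => ->; exact: oriented_asym.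
exists k, l; split=> // a; rewrite (bigD1 l)//= (bigD1 k) ?(eq_sym k)//= big1.
  by rewrite /esgn hk hl (negbTE (oriented_asym hk)) (negbTE (oriented_asym hl)) /=; ring.
move=> j /andP[jl jk]; rewrite /esgn.
have -> : oriented j (val e).1 (val e).2 = false.
  by apply: contraNF jk => /oriented_inj/(_ hk)/eqP.
have -> : oriented j (val e).2 (val e).1 = false.
  by apply: contraNF jl => /oriented_inj/(_ hl)/eqP.
by rewrite subrr mulr0.
Qed.

Lemma mk_edge_next_inj k : {in T k &, injective (fun p => mk_edge p (next (T k) p))}.
Proof.
move=> p q pk qk /mk_edge_inj[[]//|[h1 h2]].
by have := next2_neq (hT k) qk; rewrite -h1 h2 eqxx.
Qed.

Lemma sum_polygon_edges k (G : plane R * plane R -> R) :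
  \sum_(e : edge T | val e \in polygon_edges (T k)) G (val e) =
  \sum_(p <- T k) G (mk_edge p (next (T k) p)).
Proof.
rewrite -(big_map (fun p => mk_edge p (next (T k) p)) xpredT G) -/(polygon_edges _).
rewrite -(big_map val (mem (polygon_edges (T k))) G) -big_filter.
apply: perm_big; apply: uniq_perm.
- by rewrite filter_uniq// map_inj_uniq ?index_enum_uniq//; exact: val_inj.
- by rewrite map_inj_in_uniq//; exact: mk_edge_next_inj.
move=> x; rewrite mem_filter.
apply/andP/idP => [[]//|xk]; split=> //; apply/mapP.
have h : x \in edges T by apply/mem_edges; exists k.
by exists (SeqSub h); rewrite // mem_index_enum.
Qed.

(** On an edge of [k] the summand is the counterclockwise increment of [c], so the sum telescopes
    around the element. *)
Lemma sum_esgn_diff k (c : plane R -> R) :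
  \sum_(e : edge T) esgn k e * (c (val e).1 - c (val e).2) = 0.
Proof.
pose G (x : plane R * plane R) :=
  (if next (T k) x.1 == x.2 then -1 else 1) * (c x.1 - c x.2).
rewrite (bigID (fun e => val e \in polygon_edges (T k)))/= [X in _ + X]big1 ?addr0.
  rewrite (eq_bigr (fun e => G (val e))); last by move=> e he; rewrite esgnE he.
  rewrite sum_polygon_edges.
  rewrite (eq_big_seq (fun p => c (next (T k) p) - c p)).
    rewrite sumrB; apply/eqP; rewrite subr_eq0; apply/eqP.
    rewrite -(big_map (next (T k)) xpredT c); apply: perm_big.
    apply: uniq_perm => //.
      rewrite map_inj_uniq//; exact: can_inj (prev_next (uT k)).
    move=> x; apply/mapP/idP => [[y yk ->]|xk]; first by rewrite mem_next.
    by exists (prev (T k) x); rewrite ?mem_prev ?next_prev.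
  move=> p pk; rewrite /G; case: (mk_edgeP p (next (T k) p)) => -> /=.
    by rewrite eqxx mulN1r opprB.
  by rewrite (negbTE (next2_neq (hT k) pk)) mul1r.
by move=> e /negbTE he; rewrite esgnE he mul0r.
Qed.

End MeshEdges.

(** * The stream function of a divergence-free flux *)

Section StreamFunction.
Variables (R : realType) (Omega : set (plane R)) (NK : nat).
Variable (T : 'I_NK -> seq (plane R)).
Hypothesis oOmega : open Omega.
Hypothesis hm : convex_mesh T Omega.
Implicit Types (p q x y z u v : plane R) (k l : 'I_NK) (t : R) (e : edge T).

Let hT k : ccw_convex (T k). Proof. by case: hm. Qed.
Hint Resolve hT : core.

Variable eps : R.
(* The rays of the proof are parallel to (- eps, 1), along which [xi] is
   constant; [xi] and the second coordinate form a sheared coordinate system,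
   with cross u v = xi u * v.2 - u.2 * xi v. *)
Definition xi x : R := x.1 + eps * x.2.
Hypothesis generic : forall e, xi (val e).1 != xi (val e).2.

Lemma xi_conv t x y : xi (conv t x y) = (1 - t) * xi x + t * xi y.
Proof. by rewrite /xi /conv !coordE; ring. Qed.

Lemma xi_inj x y : xi x = xi y -> (x.2 : R) = y.2 -> x = y.
Proof.
by move=> h h2; apply: planeP => //; move: h; rewrite /xi h2 => /addIr.
Qed.

Lemma xi_cross x y : cross (eps, -1) (x - y) = xi x - xi y.
Proof. by rewrite /cross /xi !coordE /=; ring. Qed.

(** For [s = 1] the ray going up from [z] meets the inside of [k]; for [s = -1] the ray going down
    does. *)
Definition side (s : R) k z :=
  exists y, [/\ inside (T k) y, xi y = xi z & 0 < s * (y.2 - z.2)].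

(** The segments from [y] to [y'] and from [z] to [z'] have equal [xi] at equal parameters, and
    their height difference changes sign. So they meet, and the edge would have a point inside
    [k]. *)
Lemma side_not_both k e t t' : 0 <= t <= 1 -> 0 <= t' <= 1 ->
  side 1 k (conv t (val e).1 (val e).2) ->
  side (-1) k (conv t' (val e).1 (val e).2) -> False.
Proof.
move=> t01 t'01; set z := conv t _ _; set z' := conv t' _ _.
move=> [y [iy ey hy]] [y' [iy' ey' hy']].
rewrite mul1r in hy; rewrite mulN1r oppr_gt0 in hy'.
have D0 : 0 < (y.2 - z.2) - (y'.2 - z'.2) by rewrite subr_gt0 (lt_trans hy').
pose s := (y.2 - z.2) / ((y.2 - z.2) - (y'.2 - z'.2)).
have s0 : 0 < s by rewrite divr_gt0.
have s1 : s <= 1 by rewrite ler_pdivrMr// mul1r lerDl oppr_ge0 ltW.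
have iys : inside (T k) (conv s y y').
  by apply: inside_conv; rewrite ?s0//; exact: inside_hull.
have e1 : conv s y y' = conv s z z'.
  apply: xi_inj; first by rewrite (xi_conv s y) (xi_conv s z) ey ey'.
  have D0' : (y.2 - z.2) - (y'.2 - z'.2) != 0 by rewrite gt_eqF.
  by rewrite /s /conv !coordE; field.
move: iys; rewrite e1 conv_conv; apply: (edge_not_in_cell hm).
case/andP: t01 => h1 h2; case/andP: t'01 => h3 h4.
by apply/andP; split; nra.
Qed.

Lemma side_total k a b z : hull (T k) a -> hull (T k) b ->
  xi a < xi z -> xi z < xi b -> ~ inside (T k) z -> side 1 k z \/ side (-1) k z.
Proof.
move=> ha hb az zb nz.
have [y [iy ey]] : exists y, inside (T k) y /\ xi y = xi z.
  have [c ic] := inside_nonempty (hT k).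
  (* [w] is whichever of [a] and [b] is across the line from the inner point [c]. It is strictly off
     the line, which gives [c] a positive weight. *)
  have [w hw] : exists w, hull (T k) w /\
    (xi w < xi z <= xi c \/ xi c <= xi z < xi w).
    have [cz|zc] := leP (xi c) (xi z).
      by exists b; split=> //; right.
    by exists a; split=> //; left; rewrite az ltW.
  case: hw => hw cw.
  have cw0 : xi c - xi w != 0.
    by rewrite subr_eq0; apply/eqP => cw0; case: cw => /andP[h1 h2]; lra.
  exists (conv ((xi z - xi w) / (xi c - xi w)) w c); split; last first.
    by rewrite xi_conv; field.
  apply: inside_conv => //.
  case: cw => /andP[h1 h2].
    have h : 0 < xi c - xi w by lra.
    by apply/andP; split; [apply: divr_gt0 => //; lra|rewrite ler_pdivrMr//; lra].
  have h : 0 < xi w - xi c by lra.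
  have -> : (xi z - xi w) / (xi c - xi w) = (xi w - xi z) / (xi w - xi c).
    by have h' : xi w - xi c != 0 by [rewrite gt_eqF]; field; rewrite cw0 h'.
  by apply/andP; split; [apply: divr_gt0 => //; lra|rewrite ler_pdivrMr//; lra].
have [h|h|h] := ltgtP (y.2 : R) (z.2 : R).
- by right; exists y; rewrite mulN1r oppr_gt0 subr_lt0.
- by left; exists y; rewrite mul1r subr_gt0.
- by case: nz; rewrite -(xi_inj ey h).
Qed.

Let lo e := Num.min (xi (val e).1) (xi (val e).2).
Let hi e := Num.max (xi (val e).1) (xi (val e).2).

Let lo_hi e : lo e < hi e.
Proof.
rewrite /lo /hi; have := generic e.
rewrite neq_lt => /orP[h|h].
  by rewrite (min_idPl (ltW h)) (max_idPr (ltW h)).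
by rewrite (min_idPr (ltW h)) (max_idPl (ltW h)).
Qed.

(* The fraction of the edge [e] that lies on the left of the line xi = x. *)
Definition lam e (x : R) : R := Num.min 1 (Num.max 0 ((x - lo e) / (hi e - lo e))).

Let lam_lo e (x : R) : x <= lo e -> lam e x = 0.
Proof.
move=> h; have d0 : 0 < hi e - lo e by rewrite subr_gt0.
have h' : (x - lo e) / (hi e - lo e) <= 0 by rewrite ler_pdivrMr// mul0r subr_le0.
by rewrite /lam (max_idPl h') (min_idPr ler01).
Qed.

Let lam_hi e (x : R) : hi e <= x -> lam e x = 1.
Proof.
move=> h; have d0 : 0 < hi e - lo e by rewrite subr_gt0.
have h' : 1 <= (x - lo e) / (hi e - lo e) by rewrite ler_pdivlMr// mul1r lerB.
by rewrite /lam (min_idPl _)// le_max h' orbT.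
Qed.

(** * The sum of the local stream functions along rays *)

Section Flux.
Variable f : edge T -> R.
Hypothesis f_bnd : forall e, ~~ interior_edge Omega e -> f e = 0.
Hypothesis f_div : forall k, \sum_e esgn k e * f e = 0.

(* As [f] is divergence-free in [k], the numbers [esgn k e * f e] are the
   counterclockwise increments along the edges of a function on the boundary of
   [k]; [chord k x] is its value at the lower end minus its value at the upper
   end of the chord xi = x of [k], and 0 when there is no such chord. *)
Definition chord k (x : R) : R := \sum_e esgn k e * f e * lam e x.

Let esgn_mem k e : esgn k e != 0 -> (val e).1 \in T k /\ (val e).2 \in T k.
Proof.
rewrite /esgn; have [/oriented_mem[]//|h1] := boolP (oriented T k (val e).2 (val e).1).
by have [/oriented_mem[]//|h2] := boolP (oriented T k _ _); rewrite subrr eqxx.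
Qed.

Lemma chord_left k (x : R) : (forall p, p \in T k -> x <= xi p) -> chord k x = 0.
Proof.
move=> h; rewrite /chord big1// => e _.
have [->|/esgn_mem[h1 h2]] := eqVneq (esgn k e) 0; first by rewrite !mul0r.
by rewrite lam_lo ?mulr0// /lo le_min !h.
Qed.

(** To the right of [k] all the fractions are 1, and what remains is the total outflow from [k]. *)
Lemma chord_right k (x : R) : (forall p, p \in T k -> xi p <= x) -> chord k x = 0.
Proof.
move=> h; rewrite -[RHS](f_div k) /chord; apply: eq_bigr => e _.
have [->|/esgn_mem[h1 h2]] := eqVneq (esgn k e) 0; first by rewrite !mul0r.
by rewrite lam_hi ?mulr1// /hi ge_max !h.
Qed.

Lemma chord_range k (x : R) : chord k x != 0 ->
  (exists2 a, a \in T k & xi a < x) /\ (exists2 b, b \in T k & x < xi b).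
Proof.
move=> c0; split; apply: contrapT => h; move/eqP: c0; apply.
  apply: chord_left => p pk; rewrite leNgt; apply/negP => px; apply: h; by exists p.
apply: chord_right => p pk; rewrite leNgt; apply/negP => px; apply: h; by exists p.
Qed.

Definition above k e : Prop :=
  exists2 t, 0 <= t <= 1 & side 1 k (conv t (val e).1 (val e).2).

(* The local stream functions are added up along the ray that goes up from [p]. *)
Definition stream p : R := \sum_k (`[< side 1 k p >])%:R * chord k (xi p).

(* Whether an element is above [p] can be decided from any point of an edge
   through [p]: within the xi-range of the element, an edge stays on one side. *)
Lemma stream_edge e t : 0 <= t <= 1 ->
  stream (conv t (val e).1 (val e).2) =
  \sum_k (`[< above k e >])%:R * chord k (xi (conv t (val e).1 (val e).2)).
Proof.
move=> t01; apply: eq_bigr => k _.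
have [->|/chord_range[[a ak ax] [b bk bx]]] :=
  eqVneq (chord k (xi (conv t (val e).1 (val e).2))) 0.
  by rewrite !mulr0.
congr (_%:R * _); congr nat_of_bool; apply: asbool_equiv_eq; split; first by exists t.
move=> [t' t'01 h].
have [//|h'] := side_total (hull_mem ak) (hull_mem bk) ax bx
  (edge_not_in_cell hm (k := k) t01).
by case: (side_not_both t'01 t01 h h').
Qed.

(** The point [x] may be on the boundary of [k], so it is moved towards an inner point [c]. This
    changes [xi], and [z] is moved along the edge to match. *)
Lemma side_of_point k e t x (s : R) : 0 < t < 1 -> hull (T k) x ->
  let z := conv t (val e).1 (val e).2 in
  xi z = xi x -> 0 < s * (x.2 - z.2) ->
  exists2 t', 0 <= t' <= 1 & side s k (conv t' (val e).1 (val e).2).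
Proof.
move=> /andP[t0 t1] hx z ez h0.
have [c ic] := inside_nonempty (hT k).
have dx : xi (val e).2 - xi (val e).1 != 0 by rewrite subr_eq0 eq_sym.
(* When [x] moves by a fraction [tau], the edge parameter changes by [tau * r] and the signed height
   difference by [tau * K]. The choice of [tau] keeps the parameter in the unit interval and the
   difference positive. *)
pose r := (xi c - xi z) / (xi (val e).2 - xi (val e).1).
pose K := s * (c.2 - (z.2 + r * ((val e).2.2 - (val e).1.2)) - (x.2 - z.2)).
pose M := Num.min (Num.min t (1 - t)) (s * (x.2 - z.2)).
have M0 : 0 < M by rewrite !lt_min t0 h0 subr_gt0 t1.
have Mt : M <= t by rewrite !ge_min lexx.
have Mt1 : M <= 1 - t by rewrite !ge_min lexx orbT.
have Mh : M <= s * (x.2 - z.2) by rewrite !ge_min lexx orbT.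
have r0 : 0 <= `|r| by []. have K0 : 0 <= `|K| by [].
have D0 : 0 < M + `|r| + `|K| + 1 by lra.
pose tau := M / (M + `|r| + `|K| + 1).
have tau0 : 0 < tau by rewrite divr_gt0.
have etau : tau * (M + `|r| + `|K| + 1) = M by rewrite divfK// gt_eqF.
have taur : tau * `|r| <= M by nra.
have tauK : tau * `|K| < M by nra.
have tau1 : tau <= 1 by nra.
have : `|tau * r| <= M by rewrite normrM gtr0_norm.
have : `|tau * K| < M by rewrite normrM (gtr0_norm tau0).
rewrite ltr_norml ler_norml => /andP[k1 k2] /andP[r1 r2].
exists (t + tau * r); first by apply/andP; split; lra.
have ezt : conv (t + tau * r) (val e).1 (val e).2 =
    z + (tau * r) *: ((val e).2 - (val e).1).
  by apply: planeP; rewrite /z /conv !coordE; ring.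
exists (conv tau x c); split.
- by apply: inside_conv => //; rewrite tau0.
- rewrite xi_conv xi_conv -[xi x]ez xi_conv /r xi_conv; field.
  exact: dx.
- rewrite ezt [X in 0 < X](_ : _ = s * (x.2 - z.2) + tau * K); first by lra.
  by rewrite /K /conv !coordE; ring.
Qed.

(** Both elements contain the same point of [e'], which is above or below a point of [e], so both
    are on that side of [e]. The two points differ because distinct open edges are disjoint. *)
Lemma above_overlap k l e e' t t' : e' != e -> 0 < t < 1 -> 0 < t' < 1 ->
  xi (conv t (val e).1 (val e).2) = xi (conv t' (val e').1 (val e').2) ->
  hull (T k) (conv t' (val e').1 (val e').2) ->
  hull (T l) (conv t' (val e').1 (val e').2) ->
  `[< above k e >] = `[< above l e >].
Proof.
move=> ee' t01 t'01 exi hk hl; set z := conv t _ _ in exi.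
set z' := conv t' _ _ in exi hk hl.
have [h|h|h] := ltgtP (z.2 : R) (z'.2 : R).
- have h1 : 0 < 1 * (z'.2 - z.2) by rewrite mul1r subr_gt0.
  have ak : above k e := side_of_point t01 hk exi h1.
  have al : above l e := side_of_point t01 hl exi h1.
  by rewrite !asboolT.
- have h1 : 0 < -1 * (z'.2 - z.2) by rewrite mulN1r oppr_gt0 subr_lt0.
  have [s s01 bk] := side_of_point t01 hk exi h1.
  have [s' s'01 bl] := side_of_point t01 hl exi h1.
  by rewrite !asboolF// => -[t2 t201]; [move=> /(side_not_both t201 s'01)/(_ bl)
    |move=> /(side_not_both t201 s01)/(_ bk)].
- have zz' := xi_inj exi h.
  by move: ee'; rewrite (edges_disjoint hm t01 t'01 zz') eqxx.
Qed.

Lemma mid01 : 0 < (2%:R^-1 : R) < 1.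
Proof. by rewrite invr_gt0 ltr0n invf_lt1 ?ltr0n// ltr1n. Qed.

(** Being to the left of its edges, an element is above those that run rightwards and below those
    that run leftwards. *)
Lemma side_near k p (s : R) : p \in T k ->
  0 < s * (xi (next (T k) p) - xi p) -> side s k (conv 2%:R^-1 p (next (T k) p)).
Proof.
move=> pk h.
have c0 : 0 < cross (next (T k) p - p) (s *: ((- eps, 1) : plane R)).
  move: h; congr (_ < _); rewrite /cross /xi !coordE /=; ring.
have [d d0 hd] := near_edge (hT k) pk mid01 c0.
have := hd d; rewrite d0 lexx => /(_ isT) hi'; eexists; split; first exact: hi'.
  by rewrite /xi !coordE /=; ring.
rewrite [X in 0 < X](_ : _ = d * s ^+ 2); last by rewrite !coordE /=; ring.
rewrite mulr_gt0// exprn_even_gt0//=.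
by apply: contraTneq h => ->; rewrite mul0r ltxx.
Qed.

(** The element above [e] is the one that runs along it rightwards, and the fraction is 0 at the
    left end and 1 at the right end. Exchanging the ends of [e] changes the sign of both factors. *)
Lemma above_edge e k l : oriented T k (val e).1 (val e).2 ->
  oriented T l (val e).2 (val e).1 ->
  ((`[< above l e >])%:R - (`[< above k e >])%:R) *
  (lam e (xi (val e).1) - lam e (xi (val e).2)) = 1.
Proof.
move=> /andP[pk /eqP hk] /andP[pl /eqP hl].
have m01 : 0 <= (2%:R^-1 : R) <= 1 by case/andP: mid01 => /ltW-> /ltW->.
have em : conv 2%:R^-1 (val e).1 (val e).2 = conv 2%:R^-1 (val e).2 (val e).1.
  by rewrite convC; congr conv; field.
have := generic e; rewrite neq_lt => /orP[h|h].
  have sk : side 1 k (conv 2%:R^-1 (val e).1 (val e).2).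
    by rewrite -hk; apply: side_near => //; rewrite hk mul1r subr_gt0.
  have sl : side (-1) l (conv 2%:R^-1 (val e).1 (val e).2).
    by rewrite em -hl; apply: side_near => //; rewrite hl mulN1r oppr_gt0 subr_lt0.
  rewrite (lam_lo (e := e)); last by rewrite /lo (min_idPl (ltW h)).
  rewrite (lam_hi (e := e)); last by rewrite /hi (max_idPr (ltW h)).
  have -> : `[< above l e >] = false.
    by apply: asboolF => -[t t01] /(side_not_both t01 m01)/(_ sl).
  have -> : `[< above k e >] = true by apply: asboolT; exists 2%:R^-1.
  by rewrite /=; ring.
have sl : side 1 l (conv 2%:R^-1 (val e).1 (val e).2).
  by rewrite em -hl; apply: side_near => //; rewrite hl mul1r subr_gt0.
have sk : side (-1) k (conv 2%:R^-1 (val e).1 (val e).2).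
  by rewrite -hk; apply: side_near => //; rewrite hk mulN1r oppr_gt0 subr_lt0.
rewrite (lam_hi (e := e)); last by rewrite /hi (max_idPl (ltW h)).
rewrite (lam_lo (e := e)); last by rewrite /lo (min_idPr (ltW h)).
have -> : `[< above k e >] = false.
  by apply: asboolF => -[t t01] /(side_not_both t01 m01)/(_ sk).
have -> : `[< above l e >] = true by apply: asboolT; exists 2%:R^-1.
by rewrite /=; ring.
Qed.

Let xi_attained e (x : R) : lo e < x < hi e ->
  exists2 t, 0 < t < 1 & xi (conv t (val e).1 (val e).2) = x.
Proof.
have dx : xi (val e).2 - xi (val e).1 != 0 by rewrite subr_eq0 eq_sym.
move=> /andP[h1 h2].
exists ((x - xi (val e).1) / (xi (val e).2 - xi (val e).1)); last first.
  by rewrite xi_conv; field.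
have := generic e; rewrite neq_lt => /orP[h|h].
  move: h1 h2; rewrite /lo /hi (min_idPl (ltW h)) (max_idPr (ltW h)) => h1 h2.
  have h' : 0 < xi (val e).2 - xi (val e).1 by rewrite subr_gt0.
  by apply/andP; split; [apply: divr_gt0 => //; lra|rewrite ltr_pdivrMr//; lra].
move: h1 h2; rewrite /lo /hi (min_idPr (ltW h)) (max_idPl (ltW h)) => h1 h2.
have h' : xi (val e).2 - xi (val e).1 < 0 by rewrite subr_lt0.
by rewrite ltr_ndivrMr// ltr_ndivlMr//; apply/andP; split; lra.
Qed.

Lemma lam_disjoint e e' : hi e <= lo e' \/ hi e' <= lo e ->
  lam e' (xi (val e).1) = lam e' (xi (val e).2).
Proof.
have e1 : lo e <= xi (val e).1 <= hi e by rewrite ge_min le_max lexx.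
have e2 : lo e <= xi (val e).2 <= hi e by rewrite ge_min le_max lexx !orbT.
case/andP: e1 => l1 h1; case/andP: e2 => l2 h2.
case=> h; first by rewrite !lam_lo// (le_trans _ h).
by rewrite !lam_hi// (le_trans h).
Qed.

Lemma stream_diff e : stream (val e).1 - stream (val e).2 = f e.
Proof.
have := @stream_edge e 0; rewrite conv0 lexx ler01 => /(_ isT) ->.
have := @stream_edge e 1; rewrite conv1 lexx ler01 => /(_ isT) ->.
rewrite -sumrB.
under eq_bigr do rewrite -mulrBr /chord -sumrB mulr_sumr.
(* Collected edge by edge, each term contains the jump of [above] across the edge [e']. *)
rewrite exchange_big /=.
have fact e' : \sum_k (`[< above k e >])%:R * (esgn k e' * f e' * lam e' (xi (val e).1) -
     esgn k e' * f e' * lam e' (xi (val e).2)) =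
   f e' * (lam e' (xi (val e).1) - lam e' (xi (val e).2)) *
   \sum_k (`[< above k e >])%:R * esgn k e'.
  by rewrite mulr_sumr; apply: eq_bigr => k _; ring.
rewrite (eq_bigr _ (fun e' _ => fact e')) (bigD1 e)//= [X in _ + X]big1 ?addr0.
  have [ie|/f_bnd->] := boolP (interior_edge Omega e); last by rewrite !mul0r.
  have [k [l [hk hl ->]]] := interior_edge_sides oOmega hm ie.
  by rewrite -mulrA [X in _ * X]mulrC above_edge// mulr1.
move=> e' ee'.
have [ie|/f_bnd->] := boolP (interior_edge Omega e'); last by rewrite !mul0r.
have [k [l [hk hl ->]]] := interior_edge_sides oOmega hm ie.
have [h|h] := leP (hi e) (lo e').
  by rewrite (@lam_disjoint e e'); [rewrite subrr mulr0 mul0r|left].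
have [h'|h'] := leP (hi e') (lo e).
  by rewrite (@lam_disjoint e e'); [rewrite subrr mulr0 mul0r|right].
(* In the remaining case the [xi]-ranges overlap, and the midpoint of the overlap is attained inside
   both edges. *)
pose M := Num.max (lo e) (lo e'); pose m := Num.min (hi e) (hi e').
have Mm : M < m by rewrite /M /m gt_max !lt_min !lo_hi h h'.
have x1 : lo e < (M + m) / 2%:R < hi e.
  have hM : lo e <= M by rewrite le_max lexx.
  have hm' : m <= hi e by rewrite ge_min lexx.
  by apply/andP; split; lra.
have x2 : lo e' < (M + m) / 2%:R < hi e'.
  have hM : lo e' <= M by rewrite le_max lexx orbT.
  have hm' : m <= hi e' by rewrite ge_min lexx orbT.
  by apply/andP; split; lra.
have [t t01 et] := xi_attained x1.
have [t' t'01 et'] := xi_attained x2.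
have t'01' : 0 <= t' <= 1 by case/andP: t'01 => /ltW-> /ltW->.
have [k1 k2] := oriented_mem hk.
have [l2 l1] := oriented_mem hl.
rewrite (@above_overlap k l e e' t t') ?subrr ?mulr0 ?et ?et'//.
  by apply: hull_conv => //; exact: hull_mem.
by apply: hull_conv => //; exact: hull_mem.
Qed.

Lemma stream_leftmost p : (forall k q, q \in T k -> xi p <= xi q) -> stream p = 0.
Proof.
move=> h; rewrite /stream big1// => k _; rewrite chord_left ?mulr0//.
by move=> q; exact: h.
Qed.

End Flux.

End StreamFunction.

(** * Boundary values and interior vertices *)

Section BoundaryAndVertices.
Variables (R : realType) (Omega : set (plane R)) (NK : nat).
Variable (T : 'I_NK -> seq (plane R)).
Hypothesis oOmega : open Omega.
Hypothesis hm : convex_mesh T Omega.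
Implicit Types (p q x y z u v : plane R) (k l : 'I_NK) (t : R) (e : edge T).

Let hT k : ccw_convex (T k). Proof. by case: hm. Qed.
Hint Resolve hT : core.

Lemma mem_vertices p : reflect (exists k, p \in T k) (p \in vertices T).
Proof.
rewrite /vertices mem_undup; apply: (iffP flattenP) => [[s /mapP[k _ ->] ps]|[k pk]].
  by exists k.
by exists (T k) => //; apply/mapP; exists k; rewrite ?mem_enum.
Qed.

Lemma edge_vertices e : (val e).1 \in vertices T /\ (val e).2 \in vertices T.
Proof.
have [k /orP[]/oriented_mem[h1 h2]] := edge_oriented e;
  by split; apply/mem_vertices; exists k.
Qed.

Lemma interior_verticesP p : 
  reflect (p \in vertices T /\ Omega p) (p \in interior_vertices T Omega).
Proof.
rewrite mem_filter; apply: (iffP andP) => -[h1 h2]; split => //.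
  have /mem_vertices[k pk] := h2.
  apply: not_boundary; first exact: (hull_closure hm (hull_mem pk)).
  by move/negP: h1; apply: contra_not => h; exact/asboolP.
apply/negP => /asboolP /(boundary_not oOmega); exact.
Qed.

Lemma vertex_interior_edge p e : Omega p -> p = (val e).1 \/ p = (val e).2 ->
  interior_edge Omega e.
Proof.
move=> Op pe; apply: contrapT => /negP ne; case: pe => pe.
  by apply: (not_interior_edge oOmega ne (t := 0)); rewrite ?lexx ?ler01// conv0 -pe.
by apply: (not_interior_edge oOmega ne (t := 1)); rewrite ?lexx ?ler01// conv1 -pe.
Qed.

Lemma closed_subsegment (a b : R) p q :
  closed [set x | exists2 t, a <= t <= b & x = conv t p q].
Proof.
have -> : [set x | exists2 t, a <= t <= b & x = conv t p q] =
    (fun t : R => conv t p q) @` `[a, b].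
  apply/seteqP; split=> x [t h].
    by move=> ->; exists t => //=; rewrite in_itv.
  by move=> <-; exists t => //; move: h; rewrite /= in_itv.
apply: compact_closed; first exact: norm_hausdorff.
apply: continuous_compact; last exact: segment_compact.
apply: continuous_subspaceT => t; rewrite /conv.
apply: cvgD; apply: cvgZl; last exact: cvg_id.
by apply: cvgB; [exact: cvg_cst|exact: cvg_id].
Qed.

Lemma boundary_on_edge x : boundary Omega x ->
  exists e, exists2 t, 0 <= t <= 1 & x = conv t (val e).1 (val e).2.
Proof.
move=> bx; have nx := boundary_not oOmega bx.
have [k hk] := closure_hull hm (proj1 bx).
have nc : ~ inside (T k) x.
  rewrite -(cellE hm); case: hm => _ _ /(_ k) + _ _ => sub /sub; exact: nx.
have [p pk [t t01 ->]] := not_inside_edge (hT k) hk nc.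
have [e ee] := edge_of pk; exists e.
case: (mk_edgeP p (next (T k) p)) => h; rewrite ee h /=; first by exists t.
exists (1 - t); last by rewrite convC.
by case/andP: t01 => h1 h2; apply/andP; split; lra.
Qed.

Lemma boundary_vertices_constant (c : plane R -> R) :
  connected (boundary Omega) ->
  (forall e, ~~ interior_edge Omega e -> c (val e).1 = c (val e).2) ->
  forall p q, p \in vertices T -> q \in vertices T ->
  boundary Omega p -> boundary Omega q -> c p = c q.
Proof.
move=> cb hc p q pV qV bp bq.
(* Part of an interior edge may lie on the boundary of Omega, at the end of a
   slit.  Such an edge is cut at a point of Omega, and each part is given the
   value of [c] at its endpoint. *)
have [m hmid] : exists m : edge T -> R, forall e, interior_edge Omega e ->
    0 <= m e <= 1 /\ Omega (conv (m e) (val e).1 (val e).2).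
  have /boolp.choice[m hmm] : forall e, exists t, interior_edge Omega e ->
    0 <= t <= 1 /\ Omega (conv t (val e).1 (val e).2).
    move=> e; have [ie|ni] := boolP (interior_edge Omega e); last by exists 0.
    by have [t t01 Ot] := interior_edge_meets hm ie; exists t.
  by exists m.
(* [true] stands for the part from the first endpoint to the cut, [false] for the rest. A boundary
   edge is not cut, and both its pieces are the whole edge. *)
pose lo (i : edge T * bool) : R := if interior_edge Omega i.1 && ~~ i.2 then m i.1 else 0.
pose hi (i : edge T * bool) : R := if interior_edge Omega i.1 && i.2 then m i.1 else 1.
pose endpt (i : edge T * bool) := if i.2 then (val i.1).1 else (val i.1).2.
pose piece i := [set x | exists2 t, lo i <= t <= hi i & x = conv t (val i.1).1 (val i.1).2].
have lohi01 i t : lo i <= t <= hi i -> 0 <= t <= 1.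
  rewrite /lo /hi; case ie : (interior_edge Omega i.1) => //=.
  have [/andP[m0 m1] _] := hmid _ ie.
  by case: (i.2) => /= /andP[h1 h2]; rewrite ?h1 ?h2 ?(le_trans m0 h1) ?(le_trans h2 m1).
have cover x : boundary Omega x -> exists i, piece i x.
  move=> /boundary_on_edge[e [t /andP[t0 t1] ->]].
  case ie : (interior_edge Omega e); last first.
    by exists (e, true), t => //; rewrite /lo /hi /= ie t0 t1.
  have [tm|mt] := leP t (m e).
    by exists (e, true), t => //; rewrite /lo /hi /= ie /= t0.
  by exists (e, false), t => //; rewrite /lo /hi /= ie /= ltW.
(* A vertex in a piece is an end of the edge. If it were the end other than [endpt] on a cut edge,
   it would be the cut itself, which is in [Omega]. *)
have piece_vertex i x : x \in vertices T -> boundary Omega x -> piece i x ->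
    c (endpt i) = c x.
  move=> /mem_vertices[k xk] bx [t thl ex].
  have := boundary_not oOmega bx; rewrite {1}ex => nO.
  have /andP[t0 t1] := lohi01 _ _ thl.
  have : ~~ (0 < t < 1).
    by apply: contraL xk => t01; rewrite ex; exact: (edge_not_vertex hm).
  rewrite negb_and -!leNgt => t01.
  have [et|et] : t = 0 \/ t = 1.
  - by case/orP: t01 => h; [left|right]; apply/eqP; rewrite eq_le h ?t0 ?t1.
  - rewrite et in nO thl ex; rewrite ex conv0 /endpt.
    case: ifP => // i2; case ie : (interior_edge Omega i.1); last first.
      by rewrite hc ?ie.
    exfalso; apply: nO; have [/andP[m0 m1] +] := hmid _ ie.
    move: thl; rewrite /lo i2 ie /= => /andP[m0' _].
    by rewrite (_ : m i.1 = 0)//; apply/eqP; rewrite eq_le m0 m0'.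
  - rewrite et in nO thl ex; rewrite ex conv1 /endpt.
    case: ifP => // i2; case ie : (interior_edge Omega i.1); last first.
      by rewrite hc ?ie.
    exfalso; apply: nO; have [/andP[m0 m1] +] := hmid _ ie.
    move: thl; rewrite /hi i2 ie /= => /andP[_ m1'].
    by rewrite (_ : m i.1 = 1)//; apply/eqP; rewrite eq_le m1 m1'.
(* The two pieces of a cut edge meet only at the cut, which is not on the boundary. *)
have piece_open i t : lo i <= t <= hi i -> 
    boundary Omega (conv t (val i.1).1 (val i.1).2) -> forall j,
    j.1 = i.1 -> lo j <= t <= hi j -> c (endpt i) = c (endpt j).
  move=> thi bx j ej thj; have nO := boundary_not oOmega bx.
  rewrite /endpt ej.
  case ie : (interior_edge Omega i.1); last first.
    by case: ifP; case: ifP; rewrite // hc ?ie.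
  have [_ Om] := hmid _ ie.
  move: thi thj; rewrite /lo /hi ej ie /=.
  case: (i.2) (j.2) => -[] //= /andP[h1 h2] /andP[h3 h4]; exfalso; apply: nO.
    by rewrite (_ : t = m i.1)//; apply/eqP; rewrite eq_le h2 h3.
  by rewrite (_ : t = m i.1)//; apply/eqP; rewrite eq_le h4 h1.
have piece_value i j x : boundary Omega x -> piece i x -> piece j x ->
    c (endpt i) = c (endpt j).
  move=> bx pi pj; have [xV|xnV] := boolP (x \in vertices T).
    by rewrite (piece_vertex i x)// (piece_vertex j x).
  case: pi pj bx xnV => t thi -> [t' thj ex] bx xnV.
  have open01 i' s : lo i' <= s <= hi i' ->
      conv s (val i'.1).1 (val i'.1).2 \notin vertices T ->
      0 < s < 1.
    move=> /lohi01/andP[s0 s1] nv; have [v1 v2] := edge_vertices i'.1.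
    rewrite !lt_neqAle s0 s1 !andbT; apply/andP; split.
      by apply: contraNneq nv => <-; rewrite conv0.
    by apply: contraNneq nv => ->; rewrite conv1.
  have t01 := open01 _ _ thi xnV.
  have t'01 : 0 < t' < 1 by apply: open01 thj _; rewrite -ex.
  have eij := edges_disjoint hm t01 t'01 ex.
  have ett : t = t' by apply: (conv_inj (edge_neq hm i.1)); rewrite ex eij.
  by apply: (piece_open i t thi bx j); rewrite ?eij ?ett.
pose C (P : pred R) := \bigcup_(i in [set i | P (c (endpt i))]) piece i.
have closedC P : closed (C P).
  apply: closed_bigcup => [|i _]; last exact: closed_subsegment.
  exact: finite_finset.
have value_at x : x \in vertices T -> boundary Omega x -> forall P, C P x -> P (c x).
  by move=> xV bx P [i /= Pi pix]; rewrite -(piece_vertex i x).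
have [i pi] := cover _ bp.
(* The boundary points with value [c p] form a closed set, and so do those with other values; by
   connectedness the former is everything. *)
have : boundary Omega `&` C (pred1 (c p)) = boundary Omega.
  apply: cb.
  - exists p; split=> //; exists i => //=; apply/eqP; exact: piece_vertex.
  - exists (~` C (predC1 (c p))); first exact: closed_openC.
    apply/seteqP; split=> x [bx hx]; split=> //.
      move=> [j /= /eqP cj pj]; apply: cj.
      by case: hx => i' /= /eqP <- pi'; apply: piece_value bx pj pi'.
    have [j pj] := cover _ bx; exists j => //=.
    by apply: contrapT => /negP h; apply: hx; exists j.
  - by exists (C (pred1 (c p))).
move=> /seteqP[_ /(_ q bq)[_ h]].
by have /= /eqP := value_at q qV bq _ h.
Qed.

Section Generic.
Variable eps : R.
Hypothesis generic : forall e, xi eps (val e).1 != xi eps (val e).2.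

(** If [p] were in [Omega], some element would have a point to the left of it, but none of its
    vertices is there. *)
Lemma leftmost_boundary p : p \in vertices T ->
  (forall q, q \in vertices T -> xi eps p <= xi eps q) -> boundary Omega p.
Proof.
move=> /mem_vertices[k pk] pmin.
have cp : closure Omega p by exact: (hull_closure hm (hull_mem pk)).
apply: contrapT => nb; have Op := not_boundary cp nb.
have [t t0 [l _ hl]] := local_cover oOmega hm ((-1, 0) : plane R) Op.
have := @hull_cross_ge0 R (T l) (eps, -1) p _ hl.
rewrite xi_cross (_ : xi eps _ - _ = - t); last by rewrite /xi !coordE /=; ring.
rewrite oppr_ge0 leNgt t0 => h; suff : false by []; apply: h => q ql.
by rewrite xi_cross subr_ge0 pmin//; apply/mem_vertices; exists l.
Qed.

(** Some element at [p] has a point to the right of [p]. If both its edges at [p] went leftwards, so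
    would the element, which is contained in the angle between them. *)
Lemma rising_edge p : p \in vertices T -> Omega p ->
  exists e q, [/\ (p = (val e).1 /\ q = (val e).2) \/ (p = (val e).2 /\ q = (val e).1)
     & xi eps p < xi eps q].
Proof.
move=> /mem_vertices[k0 pk0] Op.
have [t t0 [k hp hk]] := local_cover oOmega hm ((1, 0) : plane R) Op.
have pk : p \in T k by exact: (vertex_conform hm pk0 hp).
pose q := next (T k) p; pose r := prev (T k) p.
have rk : r \in T k by rewrite mem_prev.
have nr : next (T k) r = p by rewrite next_prev//; case: (hT k).
have [e1 he1] := edge_of pk; have [e2 he2] := edge_of rk.
rewrite -/q in he1; rewrite nr in he2.
have ends e x y : val e = mk_edge x y -> (x = (val e).1 /\ y = (val e).2) \/
   (x = (val e).2 /\ y = (val e).1).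
  by case: (mk_edgeP x y) => -> ->; [left|right].
apply: contrapT => h.
have xi1 : xi eps q < xi eps p.
  rewrite ltNge le_eqVlt; apply/negP => /orP[/eqP hpq|hpq].
    by have := generic e1; case: (ends _ _ _ he1) => -[<- <-]; rewrite hpq eqxx.
  by apply: h; exists e1, q; split=> //; exact: ends.
have xi2 : xi eps r < xi eps p.
  rewrite ltNge le_eqVlt; apply/negP => /orP[/eqP hpq|hpq].
    by have := generic e2; case: (ends _ _ _ he2) => -[<- <-]; rewrite hpq eqxx.
  by apply: h; exists e2, r; split=> //; case: (ends _ _ _ he2) => -[? ?]; [right|left].
have hq x : x \in T k -> 0 <= cross (q - p) (x - p).
  by move=> xk; exact: (vertex_left (hT k) xk).
have hr x : x \in T k -> 0 <= cross (x - p) (r - p).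
  move=> xk; have := vertex_left (hT k) xk rk; rewrite nr.
  by congr (_ <= _); rewrite /cross !coordE; ring.
have := @hull_cross_ge0 R (T k) (- eps, 1) p _ hk.
rewrite (_ : cross _ _ = - t); last by rewrite /cross !coordE /=; ring.
rewrite oppr_ge0 leNgt t0 => h'; suff : false by []; apply: h' => x xk.
rewrite (_ : cross _ _ = xi eps p - xi eps x); last by rewrite /cross /xi !coordE /=; ring.
rewrite subr_ge0.
have := hr q; rewrite mem_next pk => /(_ isT).
(* Cramer's rule for [x - p] in terms of the two edge vectors, with [xi] applied. *)
have ident : (xi eps x - xi eps p) * cross (q - p) (r - p) =
   cross (x - p) (r - p) * (xi eps q - xi eps p) +
   cross (q - p) (x - p) * (xi eps r - xi eps p).
  by rewrite /cross /xi !coordE; ring.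
rewrite le_eqVlt => /orP[/eqP c0|c0]; last first.
  rewrite -subr_le0 -(pmulr_lle0 _ c0) ident.
  have := hr _ xk; have := hq _ xk; nra.
(* Collinear edge vectors would point in the same direction, and [w] would be on the wrong side of
   one of the edges. *)
have [w wk w0] := edge_left (hT k) pk; rewrite -/q in w0.
have := hr _ wk.
have d0 : q - p != 0 by exact: (edge_dir_neq0 (hT k) pk).
have := collinearE d0 (esym c0); set mu := _ / _ => er.
have : xi eps r - xi eps p = mu * (xi eps q - xi eps p).
  have -> : xi eps r - xi eps p = xi eps (r - p) by rewrite /xi !coordE; ring.
  by rewrite er /xi !coordE; ring.
move=> emu.
have mu0 : 0 < mu.
  by rewrite -(nmulr_llt0 (x := xi eps q - xi eps p)) ?subr_lt0// -emu subr_lt0.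
rewrite er (_ : cross _ _ = - (mu * cross (q - p) (w - p))); last first.
  by rewrite /cross !coordE; ring.
by rewrite oppr_ge0 leNgt mulr_gt0.
Qed.

Lemma vertex_function_eq0 (c : plane R -> R) :
  (forall p, p \notin interior_vertices T Omega -> c p = 0) ->
  (forall e, interior_edge Omega e -> c (val e).1 = c (val e).2) ->
  forall p, c p = 0.
Proof.
move=> c0 ce p0; apply/eqP/negPn/negP => cp0.
have mem p : c p != 0 -> p \in vertices T /\ Omega p.
  move=> cp; apply/interior_verticesP; apply: contraNT cp => /c0 ->; exact: eqxx.
have [p0V _] := mem _ cp0.
(* The rightmost vertex with a nonzero value; a rising edge carries the value further to the
   right. *)
have [p [pV cp pmax]] :=
  exists_argmin (fun p => - xi eps p) (P := fun p => c p != 0) p0V cp0.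
have [_ Op] := mem _ cp.
have [e [q [epq pq]]] := rising_edge pV Op.
have ie : interior_edge Omega e.
  by apply: vertex_interior_edge Op _; case: epq => -[-> _]; [left|right].
have cpq : c p = c q by case: epq => -[-> ->]; rewrite ce.
have cq : c q != 0 by rewrite -cpq.
have := pmax q (proj1 (mem _ cq)) cq.
by rewrite lerN2 leNgt pq.
Qed.

End Generic.

Lemma generic_direction : exists eps, forall e, xi eps (val e).1 != xi eps (val e).2.
Proof.
pose w e : plane R := (val e).2 - (val e).1.
pose bad e : R := `|(w e).1 / (w e).2|.
(* Equal [xi] at the ends of a non-horizontal edge would make the quotient in [bad] equal to
   [- eps]. For a horizontal edge that quotient is 0, by the convention for division by 0, and the
   first coordinates of the ends differ. *)
exists (1 + \sum_e bad e) => e; apply/eqP => h.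
set eps := 1 + _ in h.
have ew : (w e).1 + eps * (w e).2 = 0 :> R.
  by move: h; rewrite /xi /w !coordE; lra.
have bsum : bad e < eps.
  rewrite /eps (bigD1 e)//= addrCA ltrDl ltr_wpDr// ?ltr01//.
  by apply: sumr_ge0 => i _; rewrite /bad.
have [w2|w2] := eqVneq ((w e).2 : R) 0.
  have := edge_neq hm e; rewrite eq_sym -subr_eq0 -/(w e) => /eqP; apply.
  apply: planeP => //; move: ew; rewrite w2 mulr0 addr0; exact.
have ew' : (w e).1 / (w e).2 = - eps :> R.
  apply: (mulIf w2); rewrite divfK// mulNr; lra.
by move: bsum; rewrite /bad ew' normrN ltNge ler_norm.
Qed.

End BoundaryAndVertices.

(** * Divergence-free fluxes as discrete curls *)

Section CurlExact.
Variables (R : realType) (Omega : set (plane R)) (NK : nat).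
Variable (T : 'I_NK -> seq (plane R)).
Hypothesis oOmega : open Omega.
Hypothesis hm : convex_mesh T Omega.
Implicit Types (p q : plane R) (k : 'I_NK) (e : edge T).

Lemma divergence_free_curl (f : edge T -> R) :
  Omega !=set0 -> connected (boundary Omega) ->
  (forall e, ~~ interior_edge Omega e -> f e = 0) ->
  (forall k, \sum_e esgn k e * f e = 0) ->
  exists c : plane R -> R,
    (forall p, p \notin interior_vertices T Omega -> c p = 0) /\
    forall e, c (val e).1 - c (val e).2 = f e.
Proof.
move=> [x0 Ox0] cb fb fd.
have [eps gen] := generic_direction hm.
have [k0 hk0] := closure_hull hm (subset_closure Ox0).
have [p0 p0V] : exists p0, p0 \in vertices T.
  case: (hm) => /(_ k0)[_ _ [p0 [_ [p0k _ _]]]] _ _ _ _.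
  by exists p0; apply/mem_vertices; exists k0.
have [p1 [p1V _ p1min]] := exists_argmin (xi eps) (P := xpredT) p0V isT.
have p1min' q : q \in vertices T -> xi eps p1 <= xi eps q by move/p1min; exact.
have diff := stream_diff oOmega hm gen fb fd.
have p1b : boundary Omega p1 by exact: (leftmost_boundary oOmega hm p1V p1min').
have s1 : stream eps f p1 = 0.
  apply: (stream_leftmost gen) => k q qk; apply: p1min'.
  by apply/mem_vertices; exists k.
have sb q : q \in vertices T -> q \notin interior_vertices T Omega -> stream eps f q = 0.
  move=> qV; rewrite mem_filter qV andbT negbK => /asboolP bq.
  rewrite -s1; apply: (boundary_vertices_constant oOmega hm cb) => // e /fb fe0.
  by apply/eqP; rewrite -subr_eq0 diff fe0.
(* The cut-off changes nothing at the vertices of the mesh, since the stream function already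
   vanishes at the boundary ones. *)
exists (fun p => if p \in interior_vertices T Omega then stream eps f p else 0).
split=> [p /negbTE -> //|e].
have [v1 v2] := edge_vertices e; rewrite -diff.
by congr (_ - _); case: ifP => // /negbT h; rewrite sb.
Qed.

End CurlExact.

(** * Weak divergence and fluxes *)

Section PlaneMeasure.
Variable R : realType.
Implicit Types (p q x y : plane R) (s : seq (plane R)).

Local Notation MP := (measurableTypeR R * measurableTypeR R)%type.
Local Notation mu := ((@lebesgue_measure R) \x (@lebesgue_measure R))%E.

Lemma measurable_cross (u a : plane R) :
  measurable_fun setT ((fun x => cross u (x - a)) : MP -> R).
Proof.
rewrite /cross; apply: measurable_realfun.measurable_funB;
  apply: measurable_realfun.measurable_funM; try exact: measurable_cst;
  apply: measurable_realfun.measurable_funB; try exact: measurable_cst;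
  [exact: measurable_snd|exact: measurable_fst].
Qed.

Lemma measurable_inside s : measurable (inside s : set MP).
Proof.
have -> : inside s = \big[setI/setT]_(p <- s)
    [set x | 0 < cross (next s p - p) (x - p)].
  rewrite /inside -bigcap_seq; apply/seteqP; split=> x h p ps; exact: h.
apply: bigsetI_measurable => p _.
rewrite (_ : [set x | _] = setT `&`
  ((fun x => cross (next s p - p) (x - p)) : MP -> R) @^-1` `]0, +oo[).
  by apply: measurable_cross => //; exact: measurable_itv.
by rewrite setTI; apply/seteqP; split=> x /=; rewrite in_itv/= andbT.
Qed.

Lemma hull_bounded s : exists M : R, forall x, hull s x -> `|x.1| <= M /\ `|x.2| <= M.
Proof.
exists (\sum_(p <- s) (`|p.1| + `|p.2|)) => x hx; set M := \sum_(p <- s) _.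
have le_M p : p \in s -> `|p.1| + `|p.2| <= M.
  by move=> ps; rewrite /M (big_rem p)//= lerDl sumr_ge0// => i _; rewrite addr_ge0.
have M1 p : p \in s -> `|p.1| <= M /\ `|p.2| <= M.
  move=> /le_M h; have := normr_ge0 p.1; have := normr_ge0 p.2; split; lra.
(* The four sides of a square that contains all the listed points. *)
have c1 := @hull_cross_ge0 R s (0, -1) ((- M, 0) : plane R) x hx.
have c2 := @hull_cross_ge0 R s (0, 1) ((M, 0) : plane R) x hx.
have c3 := @hull_cross_ge0 R s (1, 0) ((0, - M) : plane R) x hx.
have c4 := @hull_cross_ge0 R s (-1, 0) ((0, M) : plane R) x hx.
have crossE (a b : R) (c y : plane R) :
    cross ((a, b) : plane R) (y - c) = a * (y.2 - c.2) - b * (y.1 - c.1).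
  by rewrite /cross !coordE.
rewrite !crossE /= in c1 c2 c3 c4.
rewrite !ler_norml; split; apply/andP; split.
- suff : 0 <= 0 * (x.2 - 0) - -1 * (x.1 - - M) by lra.
  by apply: c1 => p /M1[]; rewrite ler_norml => /andP[h1 h2] _; rewrite crossE /=; lra.
- suff : 0 <= 0 * (x.2 - 0) - 1 * (x.1 - M) by lra.
  by apply: c2 => p /M1[]; rewrite ler_norml => /andP[h1 h2] _; rewrite crossE /=; lra.
- suff : 0 <= 1 * (x.2 - - M) - 0 * (x.1 - 0) by lra.
  by apply: c3 => p /M1[_]; rewrite ler_norml => /andP[h1 h2]; rewrite crossE /=; lra.
- suff : 0 <= -1 * (x.2 - M) - 0 * (x.1 - 0) by lra.
  by apply: c4 => p /M1[_]; rewrite ler_norml => /andP[h1 h2]; rewrite crossE /=; lra.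
Qed.

Lemma area_rectangle (a b c d : R) : a < b -> c < d ->
  mu (`]a, b[ `*` `]c, d[) = ((b - a) * (d - c))%:E.
Proof.
move=> ab cd; rewrite product_measure1E//= !lebesgue_measure_itv/= !lte_fin ab cd.
by rewrite -!EFinD -EFinM.
Qed.

Lemma area_inside_finite s : ccw_convex s -> (mu (inside s) < +oo)%E.
Proof.
move=> hs; have [M hM] := hull_bounded s.
apply: (@le_lt_trans _ _ (mu (
    `](- (`|M| + 1)), (`|M| + 1)[ `*` `](- (`|M| + 1)), (`|M| + 1)[))).
  apply: le_measure; rewrite ?inE.
  - exact: measurable_inside.
  - by apply: measurableX; exact: measurable_itv.
  - move=> x /(inside_hull hs)/hM[]; have := ler_norm M.
    rewrite !ler_norml => h1 /andP[h2 h3] /andP[h4 h5].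
    by split; rewrite /= in_itv/=; apply/andP; split; lra.
by rewrite area_rectangle ?ltry//; have := normr_ge0 M; lra.
Qed.

Lemma area_inside_gt0 s : ccw_convex s -> (0 < mu (inside s))%E.
Proof.
move=> hs; have [c ic] := inside_nonempty hs.
have : nbhs c (inside s) by apply: open_nbhs_nbhs; split=> //; exact: open_inside.
rewrite -nbhs_ballE => -[e /= e0 he].
apply: (@lt_le_trans _ _ (mu (`](c.1 - e), (c.1 + e)[ `*` `](c.2 - e), (c.2 + e)[))).
  by rewrite area_rectangle ?lte_fin ?mulr_gt0//; lra.
apply: le_measure; rewrite ?inE.
- by apply: measurableX; exact: measurable_itv.
- exact: measurable_inside.
- move=> x [/=]; rewrite !in_itv/= => /andP[h1 h2] /andP[h3 h4]; apply: he.
  by split; rewrite /ball/= ltr_norml; apply/andP; split; lra.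
Qed.

End PlaneMeasure.

(** * The space [D_h] in terms of fluxes *)

Section WeakDivergence.
Variables (R : realType) (Omega : set (plane R)) (NK : nat).
Variable (T : 'I_NK -> seq (plane R)).
Hypothesis oOmega : open Omega.
Hypothesis hm : convex_mesh T Omega.
Implicit Types (p q x : plane R) (k l : 'I_NK) (e : edge T) (v : wg_space T).

Local Notation MP := (measurableTypeR R * measurableTypeR R)%type.
Local Notation mu := ((@lebesgue_measure R) \x (@lebesgue_measure R))%E.

Let hT k : ccw_convex (T k). Proof. by case: hm. Qed.
Hint Resolve hT : core.

(** As [v_b] is constant on the edge, this is its integral against the unit normal in the direction
    [rot90 ((val e).2 - (val e).1)]; the edge length cancels. *)
Definition flux v e : R := cross ((val e).2 - (val e).1) (v.2 e).
Definition outflow v k : R := \sum_e esgn k e * flux v e.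
Definition cell_area k : R := fine (mu (cell T k)).

Let mcell k : measurable (cell T k : set MP).
Proof. by rewrite (cellE hm); exact: measurable_inside. Qed.

Let cell_areaE k : mu (cell T k) = (cell_area k)%:E.
Proof.
rewrite /cell_area fineK// ge0_fin_numE// (cellE hm); exact: area_inside_finite.
Qed.

Lemma cell_area_gt0 k : 0 < cell_area k.
Proof. by rewrite -lte_fin -cell_areaE (cellE hm) area_inside_gt0. Qed.

Lemma cell_integral_cst k (c : R) : area_integral (cell T k) (fun=> c) = c * cell_area k.
Proof. by rewrite /area_integral Rintegral_cst. Qed.

Lemma edge_integral_cst (e : plane R * plane R) (c : R) :
  edge_integral e (fun=> c) = edge_length e * c.
Proof.
have h : fine (lebesgue_measure `[0 : R, 1]%classic) = 1.
  by rewrite lebesgue_measure_itv/= lte_fin ltr01 -EFinD subr0.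
rewrite /edge_integral Rintegral_cst; last exact: measurable_itv.
by rewrite -[in RHS](mulr1 c); congr (_ * (_ * _)); exact: h.
Qed.

Lemma edge_length_gt0 e : 0 < edge_length (val e).
Proof.
rewrite /edge_length /enorm sqrtr_gt0; apply: plane_neq0.
by rewrite subr_eq0 eq_sym (edge_neq hm).
Qed.

Lemma edge_lengthK e : edge_length (val e) ^+ 2 =
  dot ((val e).2 - (val e).1) ((val e).2 - (val e).1).
Proof. by rewrite sqr_sqrtr// /dot -!expr2 addr_ge0 ?sqr_ge0. Qed.

Lemma outflowE v k : outflow v k =
  \sum_(e : edge T | val e \in polygon_edges (T k))
    edge_length (val e) * dot (v.2 e) (outer_normal (T k) (val e)).
Proof.
rewrite /outflow (bigID (fun e => val e \in polygon_edges (T k)))/= addrC big1 ?add0r.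
  apply: eq_bigr => e he; rewrite (esgnE hm) he /outer_normal.
  have := edge_length_gt0 e; set len := edge_length _; move=> len0.
  have len1 : len != 0 by rewrite gt_eqF.
  set sg : R := if _ then _ else _.
  by rewrite /flux /cross /dot /rot90 !coordE /=; field.
by move=> e /negbTE he; rewrite (esgnE hm) he mul0r.
Qed.

(** Constant test functions have zero gradient, so the interior component drops out and a single
    scalar equation remains. *)
Lemma weak_div_specP v k d : weak_div_spec v k d <-> d * cell_area k = outflow v k.
Proof.
have spec c : (area_integral (cell T k) (fun x => d * (@cst _ R c) x) =
    - area_integral (cell T k) (fun x => dot (p1_eval (v.1 k) x) (grad (cst c) x)) +
    \sum_(e : edge T | val e \in polygon_edges (T k))
      edge_integral (val e)
        (fun x => dot (v.2 e) (outer_normal (T k) (val e)) * (@cst _ R c) x)) <->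
    c * (d * cell_area k) = c * outflow v k.
  have -> : (fun x => d * (@cst (plane R) R c) x) = (fun=> d * c) by [].
  have -> : (fun x => dot (p1_eval (v.1 k) x) (grad (cst c) x)) = (fun=> 0).
    by apply/funext => x; rewrite /grad !derive_cst /dot /= !mulr0 addr0.
  rewrite !cell_integral_cst mul0r oppr0 add0r.
  set S := \sum_(_ | _) _.
  have -> : S = c * outflow v k.
    rewrite /S outflowE mulr_sumr; apply: eq_bigr => e _.
    transitivity (edge_integral (val e)
      (fun=> dot (v.2 e) (outer_normal (T k) (val e)) * c)); first by [].
    by rewrite edge_integral_cst; ring.
  by rewrite mulrAC [d * _ * c]mulrC.
split=> [h|h phi [c ->]]; last by apply/spec; rewrite h.
have := h (cst 1); move=> /(_ (ex_intro _ 1 erefl))/spec.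
by rewrite !mul1r.
Qed.

Lemma weak_divE v k : weak_div v k = outflow v k / cell_area k.
Proof.
have A0 : cell_area k != 0 by rewrite gt_eqF// cell_area_gt0.
rewrite /weak_div; apply: xget_unique.
  by apply/weak_div_specP; rewrite divfK.
by move=> d /weak_div_specP <-; rewrite mulfK.
Qed.

Lemma sum_outflow v : Vh Omega v -> \sum_k outflow v k = 0.
Proof.
move=> hv; rewrite /outflow exchange_big big1//= => e _.
rewrite -mulr_suml; have [ie|ni] := boolP (interior_edge Omega e).
  have [k [l [_ _ /(_ (fun=> 1)) h]]] := interior_edge_sides oOmega hm ie.
  have -> : \sum_j esgn j e = 0.
    by rewrite -[RHS](subrr 1) -[RHS]h; apply: eq_bigr => j _; rewrite mul1r.
  by rewrite mul0r.
by rewrite /flux hv// /cross /= !mulr0 subrr mulr0.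
Qed.

(** Extended by 0 outside the cells, the function has the same integral over [Omega] as over the
    plane. *)
Definition cellwise (w : 'I_NK -> R) x : R := \sum_k w k * \1_(cell T k) x.

Lemma cellwise_cell w k x : cell T k x -> cellwise w x = w k.
Proof.
move=> kx; rewrite /cellwise (bigD1 k)//= indicE mem_set// mulr1 big1 ?addr0// => l lk.
rewrite indicE memNset ?mulr0// => lx.
case: hm => _ _ _ /(_ l k lk) + _; rewrite -subset0 => /(_ x); apply; exact: conj.
Qed.

Lemma cellwise_out w x : (forall k, ~ cell T k x) -> cellwise w x = 0.
Proof.
by move=> nx; rewrite /cellwise big1// => k _; rewrite indicE memNset ?mulr0.
Qed.

Lemma cellwise_sqr w x : cellwise w x ^+ 2 = cellwise (fun k => w k ^+ 2) x.
Proof.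
have [[k kx]|nx] := pselect (exists k, cell T k x).
  by rewrite !(cellwise_cell _ kx).
by rewrite !cellwise_out ?expr0n// => k kx; apply: nx; exists k.
Qed.

Lemma cellwise_restrict w : ((EFin \o cellwise w) \_ Omega)%E = EFin \o cellwise w.
Proof.
apply/funext => x; rewrite patchE; case: ifPn => // xO.
rewrite /= cellwise_out// => k kx; move/negP: xO; apply; rewrite inE.
by case: hm => _ _ /(_ k) + _ _; apply.
Qed.

Let cell_term_integrable (c : R) k :
  mu.-integrable setT (fun x : MP => (c * \1_(cell T k) x)%:E).
Proof.
have -> : (fun x : MP => (c * \1_(cell T k) x)%:E) = ((EFin \o cst c) \_ (cell T k))%E.
  apply/funext => x; rewrite patchE indicE; case: ifP => _ /=.
    by rewrite mulr1.
  by rewrite mulr0.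
apply/(integrable_mkcond _ (mcell k)).1/measurable_bounded_integrable => //.
  by rewrite -[X in (X < _)%E]/(mu (cell T k)) cell_areaE ltry.
exists `|c|; split; first exact: num_real.
by move=> M cM x _; exact: ltW.
Qed.

Lemma cellwise_integral w :
  (\int[mu]_x (cellwise w x)%:E = ((\sum_k w k * cell_area k)%R)%:E)%E.
Proof.
rewrite /cellwise; under eq_integral do rewrite -sumEFin.
rewrite integral_sum//.
rewrite -sumEFin; apply: eq_bigr => k _.
rewrite (_ : \int[mu]_x _ = \int[mu]_(x in cell T k) (w k)%:E)%E.
  rewrite -[LHS]/(\int[mu]_(x in cell T k) (cst (w k)%:E) x)%E.
  by rewrite integral_cst// -[X in (_ * X)%E]/(mu (cell T k)) cell_areaE.
rewrite [RHS]integral_mkcond; apply: eq_integral => x _.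
by rewrite patchE indicE; case: ifP => _ /=; rewrite ?mulr1 ?mulr0.
Qed.

Lemma cellwise_integrable w : mu.-integrable setT (fun x : MP => (cellwise w x)%:E).
Proof.
rewrite /cellwise (_ : (fun x => _) = (fun x => \sum_k (w k * \1_(cell T k) x)%:E)%E).
  by apply: integrable_sum => // k _; exact: cell_term_integrable.
by apply/funext => x; rewrite sumEFin.
Qed.

Lemma cellwise_integrable_on w : mu.-integrable Omega (EFin \o cellwise w).
Proof.
have /integrableP[m1 m2] := cellwise_integrable w.
apply/integrableP; split.
  exact: measurable_funS m1.
rewrite integral_mkcond; move: m2; congr (_ < _)%E; apply: eq_integral => x _.
rewrite -[in LHS]/((abse \o (EFin \o cellwise w)) x).
rewrite -[in LHS](cellwise_restrict w) /= !patchE; case: ifP => //=.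
by rewrite normr0.
Qed.

Lemma cellwise_Wh w : \sum_k w k * cell_area k = 0 -> Wh T Omega (cellwise w).
Proof.
move=> w0; split.
- have /integrableP[m1 _] := cellwise_integrable w.
  by apply: (@measurable_funS _ _ _ _ setT) => //; exact/measurable_realfun.measurable_EFinP.
- rewrite (_ : EFin \o _ = EFin \o cellwise (fun k => w k ^+ 2)).
    exact: cellwise_integrable_on.
  by apply/funext => x /=; rewrite cellwise_sqr.
- rewrite /area_integral /Rintegral integral_mkcond cellwise_restrict.
  by rewrite cellwise_integral w0.
- move=> k; exists (cst (w k)); first by exists (w k).
  by move=> x; rewrite inE => kx; rewrite (cellwise_cell _ kx).
Qed.

Lemma DhP v : Dh Omega v <-> Vh Omega v /\ forall k, outflow v k = 0.
Proof.
split=> -[hv h]; split=> //; last first.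
  move=> q _; rewrite /b big1// => k _.
  rewrite -[RHS](mul0r (cell_area k)) -cell_integral_cst.
  by congr area_integral; apply/funext => x; rewrite weak_divE h mul0r mul0r.
have A0 k : cell_area k != 0 by rewrite gt_eqF// cell_area_gt0.
(* The weak divergence itself is a test function: it has mean value zero. *)
have Wq : Wh T Omega (cellwise (weak_div v)).
  apply: cellwise_Wh; rewrite -[RHS](sum_outflow hv); apply: eq_bigr => k _.
  by rewrite weak_divE divfK.
have := h _ Wq; rewrite /b.
(* For this test function the form is a sum of squares weighted by the areas. *)
rewrite (eq_bigr (fun k => weak_div v k ^+ 2 * cell_area k)); last first.
  move=> k _; rewrite -cell_integral_cst; apply: eq_Rintegral => x.
  by rewrite inE => kx; rewrite (cellwise_cell _ kx) expr2.
move=> /eqP; rewrite psumr_eq0; last first.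
  by move=> k _; rewrite mulr_ge0 ?sqr_ge0// ltW// cell_area_gt0.
move=> /allP h2 k; have := h2 k (mem_index_enum k).
rewrite /= mulf_eq0 (negbTE (A0 k)) orbF sqrf_eq0 weak_divE mulf_eq0 invr_eq0.
by rewrite (negbTE (A0 k)) orbF => /eqP.
Qed.

End WeakDivergence.

(** * Spanning and linear independence *)

Section SpanOfMap.
Variables (K : fieldType) (V : vectType K) (I : eqType) (F : I -> V).
Implicit Types (r : seq I) (c : I -> K).

Lemma span_ind (P : V -> Prop) (X : seq V) :
  P 0 -> (forall a u v, P u -> P v -> P (a *: u + v)) ->
  (forall u, u \in X -> P u) -> forall v, v \in <<X>>%VS -> P v.
Proof.
move=> P0 Plin; elim: X => [|u X IH] PX v.
  by rewrite span_nil memv0 => /eqP->.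
rewrite span_cons => /memv_addP[_ /vlineP[a ->] [w wX ->]].
apply: Plin; first by apply: PX; exact: mem_head.
by apply: IH wX => u' u'X; apply: PX; rewrite inE u'X orbT.
Qed.

Lemma span_mapP r v : uniq r -> v \in <<map F r>>%VS ->
  exists c, v = \sum_(i <- r) c i *: F i.
Proof.
elim: r v => [|i r IH] v /=.
  by rewrite span_nil memv0 => _ /eqP->; exists (fun=> 0); rewrite big_nil.
move=> /andP[ir ur]; rewrite span_cons => /memv_addP[_ /vlineP[a ->] [w wX ->]].
have [c ->] := IH _ ur wX; exists (fun j => if j == i then a else c j).
rewrite big_cons eqxx; congr (_ + _); apply: eq_big_seq => j jr.
by case: eqP => // ji; move: ir; rewrite -ji jr.
Qed.

Lemma free_map r : uniq r ->
  (forall c, \sum_(i <- r) c i *: F i = 0 -> forall i, i \in r -> c i = 0) ->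
  free (map F r).
Proof.
elim: r => [|i r IH] /=; first by rewrite nil_free.
move=> /andP[ir ur] h; rewrite free_cons; apply/andP; split.
  apply/negP => /(span_mapP ur)[c ec].
  have := h (fun j => if j == i then -1 else c j).
  rewrite big_cons eqxx (eq_big_seq (fun j => c j *: F j)); last first.
    by move=> j jr; case: eqP => // ji; move: ir; rewrite -ji jr.
  rewrite -ec scaleN1r addNr => /(_ erefl i); rewrite mem_head eqxx => /(_ isT)/eqP.
  by rewrite oppr_eq0 oner_eq0.
apply: IH => // c c0 j jr.
have := h (fun j => if j == i then 0 else c j).
rewrite big_cons eqxx scale0r add0r (eq_big_seq (fun j => c j *: F j)); last first.
  by move=> k kr; case: eqP => // ki; move: ir; rewrite -ki kr.
move=> /(_ c0 j); rewrite inE jr orbT => /(_ isT).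
by case: eqP => // ji; move: ir; rewrite -ji jr.
Qed.

Lemma free_map_coef r c : uniq r -> free (map F r) ->
  \sum_(i <- r) c i *: F i = 0 -> forall i, i \in r -> c i = 0.
Proof.
elim: r => //= i r IH /andP[ir ur]; rewrite free_cons big_cons => /andP[ni fr] h.
have ci : c i = 0.
  apply/eqP/negPn/negP => ci; move/negP: ni; apply.
  have -> : F i = (c i)^-1 *: (c i *: F i) by rewrite scalerA mulVf// scale1r.
  have -> : c i *: F i = - (\sum_(j <- r) c j *: F j).
    by apply/eqP; rewrite -addr_eq0 h.
  rewrite rpredZ// rpredN big_seq rpred_sum// => j jr.
  by rewrite rpredZ// memv_span// map_f.
move=> j; rewrite inE => /orP[/eqP->//|]; apply: IH => //.
by move: h; rewrite ci scale0r add0r.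
Qed.

End SpanOfMap.

(** * The generators as a basis *)

Section Basis.
Variables (R : realType) (Omega : set (plane R)) (NK : nat).
Variable (T : 'I_NK -> seq (plane R)).
Hypothesis oOmega : open Omega.
Hypothesis Omega_neq0 : Omega !=set0.
Hypothesis cb : connected (boundary Omega).
Hypothesis hm : convex_mesh T Omega.
Variables (Phi : 'I_NK -> 'I_6 -> wg_space T) (t : edge T -> plane R).
Hypothesis hPhi : interior_basis Phi.
Hypothesis ht : forall e, interior_edge Omega e -> unit_tangent (val e) (t e).
Implicit Types (p q x : plane R) (k l : 'I_NK) (e : edge T) (u v : wg_space T).

Let Phis := [seq Phi k j | k <- enum 'I_NK, j <- enum 'I_6].
Let Upsilons := [seq Upsilon t e | e <- enum (interior_edge Omega)].
Let Lambdas := [seq Lambda T p | p <- interior_vertices T Omega].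

Let uniq_iv : uniq (interior_vertices T Omega).
Proof. by rewrite filter_uniq// undup_uniq. Qed.

Lemma wg_ext u v : (forall k, u.1 k = v.1 k) -> (forall e, u.2 e = v.2 e) -> u = v.
Proof. by case: u v => [u1 u2] [v1 v2] /= /ffunP -> /ffunP ->. Qed.

Lemma wg_sum1 (I : Type) (r : seq I) (P : pred I) (F : I -> wg_space T) k :
  (\sum_(i <- r | P i) F i).1 k = \sum_(i <- r | P i) (F i).1 k.
Proof.
by apply: (big_morph (fun v : wg_space T => v.1 k)) => [u v|]; rewrite ffunE.
Qed.

Lemma wg_sum2 (I : Type) (r : seq I) (P : pred I) (F : I -> wg_space T) e :
  (\sum_(i <- r | P i) F i).2 e = \sum_(i <- r | P i) (F i).2 e.
Proof.
by apply: (big_morph (fun v : wg_space T => v.2 e)) => [u v|]; rewrite ffunE.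
Qed.

Lemma wg_scale1 (a : R) u k : (a *: u).1 k = a *: u.1 k.
Proof. exact: ffunE. Qed.

Lemma wg_scale2 (a : R) u e : (a *: u).2 e = a *: u.2 e.
Proof. exact: ffunE. Qed.

Lemma wg_add1 u v k : (u + v).1 k = u.1 k + v.1 k.
Proof. exact: ffunE. Qed.

Lemma wg_add2 u v e : (u + v).2 e = u.2 e + v.2 e.
Proof. exact: ffunE. Qed.

Lemma wg_zero1 k : (0 : wg_space T).1 k = 0.
Proof. exact: ffunE. Qed.

Lemma wg_zero2 e : (0 : wg_space T).2 e = 0.
Proof. exact: ffunE. Qed.

Lemma flux_linear e (a : R) u v : flux (a *: u + v) e = a * flux u e + flux v e.
Proof.
rewrite /flux wg_add2 wg_scale2.
by rewrite /cross !coordE; ring.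
Qed.

Lemma flux0 e : flux (0 : wg_space T) e = 0.
Proof. by rewrite /flux wg_zero2 /cross /= !mulr0 subrr. Qed.

Lemma flux_sum e (I : Type) (r : seq I) (P : pred I) (F : I -> wg_space T) :
  flux (\sum_(i <- r | P i) F i) e = \sum_(i <- r | P i) flux (F i) e.
Proof.
apply: (big_morph (fun v => flux v e)); last exact: flux0.
by move=> u v; have := flux_linear e 1 u v; rewrite scale1r mul1r.
Qed.

Lemma fluxZ e (a : R) u : flux (a *: u) e = a * flux u e.
Proof. by have := flux_linear e a u 0; rewrite flux0 !addr0. Qed.

Lemma outflow_linear k (a : R) u v :
  outflow (a *: u + v) k = a * outflow u k + outflow v k.
Proof.
rewrite /outflow mulr_sumr -big_split; apply: eq_bigr => e _ /=.
by rewrite flux_linear; ring.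
Qed.

Lemma tangent_flux e : interior_edge Omega e ->
  cross ((val e).2 - (val e).1) (t e) = 0 /\ t e != 0.
Proof.
move=> /ht[h1 h2]; split=> //; apply/eqP => te; move: h1.
by rewrite te /enorm /dot /= !mulr0 addr0 sqrtr0 => /eqP; rewrite eq_sym oner_eq0.
Qed.

Lemma flux_Upsilon e e' : interior_edge Omega e -> flux (Upsilon t e) e' = 0.
Proof.
move=> ie; rewrite /flux /Upsilon /= ffunE; case: eqP => [->|_].
  by have [] := tangent_flux ie.
by rewrite /cross /= !mulr0 subrr.
Qed.

(** The normal is the quarter turn of the direction away from [p], and the two factors [1 / |e|]
    cancel the squared length. *)
Lemma flux_Lambda p e :
  flux (Lambda T p) e = (p == (val e).1)%:R - (p == (val e).2)%:R.
Proof.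
have -> : flux (Lambda T p) e = cross ((val e).2 - (val e).1)
    (if (p == (val e).1) || (p == (val e).2)
     then (edge_length (val e))^-1 *: ccw_normal p (val e) else 0).
  by rewrite /flux /= ffunE.
have len0 := edge_length_gt0 hm e; have len2 := edge_lengthK e.
have len1 : edge_length (val e) != 0 by rewrite gt_eqF.
have ne := edge_neq hm e.
have crossE (a : R) (d : plane R) : cross d ((edge_length (val e))^-1 *:
   ((edge_length (val e))^-1 *: rot90 (a *: d))) = a * dot d d / edge_length (val e) ^+ 2.
  by rewrite /cross /dot /rot90 !coordE /=; field.
have dd0 : dot ((val e).2 - (val e).1) ((val e).2 - (val e).1) != 0.
  by rewrite -len2 expf_neq0.
rewrite /ccw_normal; have [->|p1] := eqVneq p (val e).1; rewrite ?orTb ?orFb.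
  rewrite (negbTE ne) -[in rot90 _](scale1r ((val e).2 - (val e).1)) crossE.
  by rewrite len2 mul1r divff// subr0.
have [p2|p2] := eqVneq p (val e).2; last by rewrite /cross /= !mulr0 subrr.
rewrite -[in rot90 _]opprB -[in rot90 _]scaleN1r crossE len2 -mulrA divff//.
by rewrite mulr1 sub0r.
Qed.

(** As [c] vanishes elsewhere, the sum picks its value even at an endpoint that is no interior
    vertex. *)
Lemma flux_sum_Lambda (c : plane R -> R) e :
  (forall p, p \notin interior_vertices T Omega -> c p = 0) ->
  flux (\sum_(p <- interior_vertices T Omega) c p *: Lambda T p) e =
  c (val e).1 - c (val e).2.
Proof.
move=> c0; rewrite flux_sum.
have sel q : \sum_(p <- interior_vertices T Omega) c p * (p == q)%:R = c q.
  have [qiv|qiv] := boolP (q \in interior_vertices T Omega).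
    rewrite (bigD1_seq q)//= eqxx mulr1 big1 ?addr0// => p /negbTE->.
    by rewrite mulr0.
  rewrite c0// big_seq big1// => p piv; case: eqP; last by rewrite mulr0.
  by move=> pq; move: qiv; rewrite -pq piv.
rewrite -(sel (val e).1) -(sel (val e).2) -sumrB; apply: eq_bigr => p _.
by rewrite fluxZ flux_Lambda mulrBr.
Qed.

Lemma Vh_Lambda p : p \in interior_vertices T Omega -> Vh Omega (Lambda T p).
Proof.
move=> /(interior_verticesP oOmega hm)[_ Op] e ne; rewrite /Lambda /= ffunE.
case: ifP => // /orP pe; move/negP: ne; case.
by apply: (vertex_interior_edge oOmega Op); case: pe => /eqP ->; [left|right].
Qed.

Lemma Dh_generators_sub v : v \in Dh_generators Omega Phi t -> Dh Omega v.
Proof.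
move=> vX; apply/(DhP oOmega hm).
have outflow0 : (forall e, flux v e = 0) -> forall k, outflow v k = 0.
  by move=> h k; rewrite /outflow big1// => e _; rewrite h mulr0.
move: vX; rewrite !mem_cat => /or3P[/allpairsP[[k j] [_ _ ->]]|/mapP[e]|/mapP[p piv ->]].
- have [h2 _ _] := hPhi k.
  split; first by move=> e _; rewrite h2 ffunE.
  move=> l; rewrite /outflow big1// => e _.
  by rewrite /flux h2 ffunE /cross /= !mulr0 subrr mulr0.
- rewrite mem_enum => ie ->; split.
    move=> e' ne'; rewrite /= ffunE; case: eqP => // ee'.
    by case/negP: ne'; rewrite ee'; exact: ie.
  move=> l; rewrite /outflow big1// => e' _; rewrite flux_Upsilon ?mulr0//.
- split; first exact: Vh_Lambda.
  (* The fluxes of [Lambda T p] are the differences of the indicator of [p], which telescope around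
     each element. *)
  move=> l; rewrite -[RHS](sum_esgn_diff hm l (fun q => (p == q)%:R)).
  by apply: eq_bigr => e _; rewrite flux_Lambda.
Qed.

Lemma span_sub_Dh v : v \in <<Dh_generators Omega Phi t>>%VS -> Dh Omega v.
Proof.
apply: span_ind; last exact: Dh_generators_sub.
  apply/(DhP oOmega hm); split; first by move=> e _; exact: wg_zero2.
  by move=> k; rewrite /outflow big1// => e _; rewrite flux0 mulr0.
move=> a u w /(DhP oOmega hm)[Vu u0] /(DhP oOmega hm)[Vw w0]; apply/(DhP oOmega hm).
split; last by move=> k; rewrite outflow_linear u0 w0 mulr0 addr0.
by move=> e ne; rewrite wg_add2 wg_scale2 Vu// Vw// scaler0 addr0.
Qed.

Lemma Phi_edge k j e : (Phi k j).2 e = 0.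
Proof. by have [-> _ _] := hPhi k; rewrite ffunE. Qed.

Lemma Phi_cell k l j : k != l -> (Phi k j).1 l = 0.
Proof. by move=> kl; have [_ -> //] := hPhi k; rewrite eq_sym. Qed.

Lemma Upsilon_cell e k : (Upsilon t e).1 k = 0.
Proof. exact: ffunE. Qed.

Lemma Upsilon_edge e e' : (Upsilon t e).2 e' = if e' == e then t e else 0.
Proof. exact: ffunE. Qed.

Lemma Lambda_cell p k : (Lambda T p).1 k = 0.
Proof. exact: ffunE. Qed.

Lemma interior_part_span v : (forall e, v.2 e = 0) -> v \in <<Phis>>%VS.
Proof.
move=> v2.
have /boolp.choice[a ha] : forall k, exists a : 'I_6 -> R,
    v.1 k = \sum_(j <- enum 'I_6) a j *: (Phi k j).1 k.
  move=> k; have [_ _ /andP[/eqP sp _]] := hPhi k.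
  apply: span_mapP; first exact: enum_uniq.
  by rewrite sp memvf.
have -> : v = \sum_k \sum_(j <- enum 'I_6) a k j *: Phi k j.
  apply: wg_ext => [l|e].
    rewrite wg_sum1 (bigD1 l)//= [X in _ + X]big1 ?addr0.
      by rewrite wg_sum1 ha; apply: eq_bigr => j _; rewrite wg_scale1.
    move=> k kl; rewrite wg_sum1 big1// => j _.
    by rewrite wg_scale1 Phi_cell// scaler0.
  rewrite v2 wg_sum2 big1// => k _; rewrite wg_sum2 big1// => j _.
  by rewrite wg_scale2 Phi_edge scaler0.
apply: rpred_sum => k _; apply: rpred_sum => j _; apply: rpredZ; apply: memv_span.
by apply/allpairsP; exists (k, j); rewrite !mem_enum.
Qed.

(** Without flux, [v_b] is parallel to the edge, as is the nonzero vector [t e]. *)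
Lemma tangential_part_span v : (forall k, v.1 k = 0) -> Vh Omega v ->
  (forall e, flux v e = 0) -> v \in <<Upsilons>>%VS.
Proof.
move=> v1 Vv fv.
have /boolp.choice[b hb] : forall e, exists b : R,
    interior_edge Omega e -> v.2 e = b *: t e.
  move=> e; have [ie|ni] := boolP (interior_edge Omega e); last by exists 0.
  have [ct t0] := tangent_flux ie.
  have d0 : (val e).2 - (val e).1 != 0 by rewrite subr_eq0 eq_sym (edge_neq hm).
  have := collinearE d0 ct; set mu := _ / _ => et.
  have mu0 : mu != 0 by apply: contraNneq t0 => m0; rewrite et m0 scale0r.
  have := collinearE d0 (fv e); set nu := _ / _ => ev.
  by exists (nu / mu) => _; rewrite ev et scalerA divfK.
have -> : v = \sum_(e in interior_edge Omega) b e *: Upsilon t e.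
  apply: wg_ext => [k|e].
    by rewrite v1 wg_sum1 big1// => e _; rewrite wg_scale1 Upsilon_cell scaler0.
  rewrite wg_sum2.
  under eq_bigr => e' _ do rewrite wg_scale2 Upsilon_edge.
  have [ie|ni] := boolP (interior_edge Omega e).
    rewrite (bigD1 e)//= eqxx -hb// big1 ?addr0// => e' /andP[_ /negbTE ee'].
    by rewrite eq_sym ee' scaler0.
  rewrite Vv// big1// => e' ie'; case: eqP; last by rewrite scaler0.
  by move=> ee'; case/negP: ni; rewrite ee'; exact: ie'.
apply: rpred_sum => e ie; apply: rpredZ; apply: memv_span.
by apply/mapP; exists e; rewrite ?mem_enum.
Qed.

Lemma Dh_sub_span v : Dh Omega v -> v \in <<Dh_generators Omega Phi t>>%VS.
Proof.
move=> /(DhP oOmega hm)[Vv v0].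
have fb e : ~~ interior_edge Omega e -> flux v e = 0.
  by move=> ne; rewrite /flux Vv// /cross /= !mulr0 subrr.
have [c [c0 hc]] := divergence_free_curl oOmega hm Omega_neq0 cb fb v0.
pose L := \sum_(p <- interior_vertices T Omega) c p *: Lambda T p.
pose v1 : wg_space T := (v.1, 0); pose v2 : wg_space T := (0, v.2).
(* [L] has the same fluxes as [v], so the middle term is purely tangential. *)
have -> : v = v1 + ((v2 + (-1) *: L) + L).
  rewrite scaleN1r subrK; apply: wg_ext => [k|e].
    by rewrite wg_add1 /= ffunE addr0.
  by rewrite wg_add2 /= ffunE add0r.
rewrite /Dh_generators span_cat; apply: memv_add.
  by apply: interior_part_span => e; rewrite /= ffunE.
rewrite span_cat; apply: memv_add; last first.
  rewrite /L big_seq; apply: rpred_sum => p piv; apply: rpredZ; apply: memv_span.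
  exact: map_f.
apply: tangential_part_span => [k|e ne|e].
- rewrite wg_add1 wg_scale1 wg_sum1 big1 ?scaler0 ?addr0; first exact: ffunE.
  by move=> p _; rewrite wg_scale1 Lambda_cell scaler0.
- rewrite wg_add2 wg_scale2 wg_sum2 big_seq big1; first by rewrite scaler0 addr0 Vv.
  by move=> p piv; rewrite wg_scale2 (Vh_Lambda piv ne) scaler0.
- rewrite addrC flux_linear mulN1r flux_sum_Lambda// hc.
  by rewrite -[flux v2 e]/(flux v e) addNr.
Qed.

Lemma free_Phis : free Phis.
Proof.
have -> : Phis = map (fun kj => Phi kj.1 kj.2)
    [seq (k, j) | k <- enum 'I_NK, j <- enum 'I_6].
  by rewrite map_allpairs.
apply: free_map.
  by apply: allpairs_uniq; rewrite ?enum_uniq// => -[? ?] [? ?].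
move=> c; rewrite big_allpairs => h [k j] _.
have {}h : \sum_(j <- enum 'I_6) c (k, j) *: (Phi k j).1 k = 0.
  have := congr1 (fun u : wg_space T => u.1 k) h.
  rewrite wg_zero1 wg_sum1 (bigD1_seq k) ?mem_enum ?enum_uniq//= [X in _ + X]big1 ?addr0.
    rewrite wg_sum1 => h2; rewrite -[RHS]h2.
    by apply: eq_bigr => i _; rewrite wg_scale1.
  move=> l lk; rewrite wg_sum1 big1// => i _.
  by rewrite wg_scale1 Phi_cell// scaler0.
have [_ _ /andP[_ fr]] := hPhi k.
apply: (free_map_coef (F := fun j => (Phi k j).1 k) (c := fun j => c (k, j)) _ fr h);
  by rewrite ?enum_uniq ?mem_enum.
Qed.

Lemma free_Upsilons : free Upsilons.
Proof.
apply: free_map; first exact: enum_uniq.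
move=> b h e eint.
have ie : interior_edge Omega e by move: eint; rewrite mem_enum.
have [_ t0] := tangent_flux ie.
have := congr1 (fun u : wg_space T => u.2 e) h.
rewrite wg_zero2 wg_sum2.
under eq_bigr => e' _ do rewrite wg_scale2 Upsilon_edge.
rewrite (bigD1_seq e) ?enum_uniq//= eqxx big1 ?addr0 => [/eqP|e' /negbTE ee'].
  by rewrite scaler_eq0 (negbTE t0) orbF => /eqP.
by rewrite eq_sym ee' scaler0.
Qed.

(** Assuming only zero fluxes serves both the independence of the [Lambda] functions and their
    separation from the [Upsilon] functions. *)
Lemma Lambda_flux_coef (c : plane R -> R) :
  (forall e, flux (\sum_(p <- interior_vertices T Omega) c p *: Lambda T p) e = 0) ->
  forall p, p \in interior_vertices T Omega -> c p = 0.
Proof.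
move=> h p piv.
pose c' q := if q \in interior_vertices T Omega then c q else 0.
have c'0 q : q \notin interior_vertices T Omega -> c' q = 0.
  by rewrite /c' => /negbTE ->.
have [eps gen] := generic_direction hm.
have ce e : interior_edge Omega e -> c' (val e).1 = c' (val e).2.
  move=> _; have := flux_sum_Lambda e c'0.
  rewrite (eq_big_seq (fun q => c q *: Lambda T q)).
    by rewrite h => /esym/eqP; rewrite subr_eq0 => /eqP.
  by move=> q qiv; rewrite /c' qiv.
by have := vertex_function_eq0 oOmega hm gen c'0 ce p; rewrite /c' piv.
Qed.

Lemma free_Lambdas : free Lambdas.
Proof.
apply: free_map => // c h; apply: Lambda_flux_coef => e; by rewrite h flux0.
Qed.

(** The [Upsilon] functions have no flux, which separates them from the [Lambda] functions; the
    [Phi] functions have no edge component, and the others no interior one. *)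
Lemma free_Dh_generators : free (Dh_generators Omega Phi t).
Proof.
rewrite /Dh_generators cat_free free_Phis cat_free free_Upsilons free_Lambdas /=.
apply/andP; split; apply/directv_addP/eqP; rewrite -subv0;
  apply/subvP => v /memv_capP[h1 h2].
  rewrite memv0; apply/eqP.
  move: h2 => /(span_mapP uniq_iv)[c ev].
  have fv e : flux v e = 0.
    apply: (span_ind (P := fun u => flux u e = 0)) h1; first exact: flux0.
      by move=> a u w u0 w0; rewrite flux_linear u0 w0 mulr0 addr0.
    by move=> u /mapP[e']; rewrite mem_enum => ie ->; exact: flux_Upsilon.
  have c0 := @Lambda_flux_coef c; rewrite -ev in c0.
  rewrite ev big_seq; apply: big1 => p piv.
  by rewrite (c0 fv p piv) scale0r.
have v2 e : v.2 e = 0.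
  apply: (span_ind (P := fun u : wg_space T => u.2 e = 0)) h1; first exact: wg_zero2.
    by move=> a u w u0 w0; rewrite wg_add2 wg_scale2 u0 w0 scaler0 addr0.
  by move=> u /allpairsP[[k j] [_ _ ->]]; exact: Phi_edge.
have v1 k : v.1 k = 0.
  apply: (span_ind (P := fun u : wg_space T => u.1 k = 0)) h2; first exact: wg_zero1.
    by move=> a u w u0 w0; rewrite wg_add1 wg_scale1 u0 w0 scaler0 addr0.
  move=> u; rewrite mem_cat => /orP[]/mapP[? _ ->];
    [exact: Upsilon_cell|exact: Lambda_cell].
rewrite memv0; apply/eqP/wg_ext => [k|e]; first by rewrite v1 wg_zero1.
by rewrite v2 wg_zero2.
Qed.

End Basis.

(** Connectedness of the boundary makes the stream function vanish at all boundary vertices; around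
    a hole it could take another constant. *)
Theorem theorem3p4 (R : realType) (Omega : set (plane R)) (NK : nat)
    (T : 'I_NK -> seq (plane R)) (c : wg_constants R)
    (Phi : 'I_NK -> 'I_6 -> wg_space T) (t : edge T -> plane R) :
  polygonal_domain Omega ->
  connected (boundary Omega) ->
  convex_mesh T Omega ->
  mesh_regular T c ->
  interior_basis Phi ->
  (forall e, interior_edge Omega e -> unit_tangent (val e) (t e)) ->
  let X := Dh_generators Omega Phi t in
  Dh Omega = [set v | v \in <<X>>%VS] /\ free X.
Proof.
move=> [On0 oO _ _ _] cb hm _ hPhi ht X; split.
  by apply/seteqP; split=> v; [exact: Dh_sub_span|exact: span_sub_Dh].
exact: (free_Dh_generators oO hm hPhi ht).
Qed.
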